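(* Let $X$ be a smooth cell complex given by a $\delta$-sequence $Z\colon\delta\to\mathbf{Diff}$, where $\delta$ is a countable ordinal. Then for every $D$-open cover $\mathcal U=\{U_\lambda\}_{\lambda\in\Lambda}$ of $X$ there exists a partition of unity $\{\psi_\lambda\colon X\to\mathbf{R}\mid\lambda\in\Lambda\}$ by smooth functions subordinate to $\mathcal U$.
   Context: $\mathbf{Diff}$ denotes the category of diffeological spaces and smooth maps. For a diffeological space $X$, its $D$-topology is the finest topology on the underlying set making all plots continuous; ''$D$-open'' refers to it. $I^n$ is the $n$-cube and $\partial I^n$ its boundary, with the subspace diffeology from $\mathbf{R}^n$ (standard diffeology). A $\delta$-sequence ($\delta$ an ordinal) is a functor $Z\colon\delta\to\mathbf{Diff}$ such that for every limit ordinal $\beta<\delta$ the induced map $\operatorname{colim}_{\alpha<\beta}Z_\alpha\to Z_\beta$ is an isomorphism. A diffeological space $X$ is a smooth cell complex given by $Z$ if $Z_0=\emptyset$, $X=\operatorname{colim}Z$, and for each $\beta$ with $\beta+1<\delta$ there is $n_{\beta+1}\ge0$ and a pushout square in $\mathbf{Diff}$ exhibiting $Z_{\beta+1}=Z_\beta\cup_{\phi_{\beta+1}}I^{n_{\beta+1}}$ for a smooth attaching map $\phi_{\beta+1}\colon\partial I^{n_{\beta+1}}\to Z_\beta$. For a smooth $\psi\colon X\to\mathbf{R}$, $\operatorname{supp}\psi$ is the $D$-closure of $\{x\mid\psi(x)\ne0\}$. A collection of subsets of $X$ is locally finite if each point has a $D$-open neighbourhood meeting only finitely many members. A family of smooth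 maps $\{\psi_\lambda\colon X\to\mathbf{R}\}_{\lambda\in\Lambda}$ is a partition of unity subordinate to a $D$-open cover $\{U_\lambda\}_{\lambda\in\Lambda}$ if: $0\le\psi_\lambda\le1$ for all $\lambda$; $\operatorname{supp}\psi_\lambda\subset U_\lambda$ for all $\lambda$; $\{\operatorname{supp}\psi_\lambda\}_\lambda$ is locally finite; and $\sum_\lambda\psi_\lambda(x)=1$ for all $x\in X$. *)

(* Defs.v *)
From Stdlib Require Vectors.Fin.
From Stdlib Require Import Reals List.
Open Scope R_scope.

Definition Rn (n : nat) : Type := Fin.t n -> R.

(* Open subsets of R^n (sup-norm balls generate the usual topology). *)
Definition is_open {n : nat} (U : Rn n -> Prop) : Prop :=
  forall x, U x -> exists eps, 0 < eps /\
    forall y : Rn n, (forall i, Rabs (y i - x i) < eps) -> U y.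

Definition shift {n : nat} (i : Fin.t n) (t : R) (x : Rn n) : Rn n :=
  fun j => if Fin.eq_dec i j then x j + t else x j.

Definition cont_on {n : nat} (U : Rn n -> Prop) (g : sig U -> R) : Prop :=
  forall (x : sig U) eps, 0 < eps -> exists del, 0 < del /\
    forall y : sig U, (forall j, Rabs (proj1_sig y j - proj1_sig x j) < del) ->
      Rabs (g y - g x) < eps.

Definition has_partial {n : nat} (U : Rn n -> Prop) (g : sig U -> R)
  (i : Fin.t n) (x : sig U) (l : R) : Prop :=
  forall eps, 0 < eps -> exists del, 0 < del /\
    forall t (h : U (shift i t (proj1_sig x))), t <> 0 -> Rabs t < del ->
      Rabs ((g (exist U _ h) - g x) / t - l) < eps.

Fixpoint Ck {n : nat} (U : Rn n -> Prop) (k : nat) (g : sig U -> R) : Prop :=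
  match k with
  | O => cont_on U g
  | S k' => cont_on U g /\
      forall i : Fin.t n, exists dg : sig U -> R,
        (forall x, has_partial U g i x (dg x)) /\ Ck U k' dg
  end.

Definition smooth_fun {n : nat} (U : Rn n -> Prop) (g : sig U -> R) : Prop :=
  forall k, Ck U k g.

Definition smooth_map {n m : nat} (U : Rn n -> Prop) (F : sig U -> Rn m) : Prop :=
  forall j : Fin.t m, smooth_fun U (fun u => F u j).

(* A set with a candidate family of plots; plots are maps from open
   domains U of some R^n. *)
Record DiffSp : Type := {
  carrier :> Type;
  plot : forall (n : nat) (U : Rn n -> Prop), (sig U -> carrier) -> Prop
}.

Definition IsDiffeology (X : DiffSp) : Prop :=
  (forall n U p, plot X n U p -> is_open U) /\
  (forall n (U : Rn n -> Prop) (x : X), is_open U -> plot X n U (fun _ => x)) /\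
  (forall n m (U : Rn n -> Prop) (V : Rn m -> Prop) (p : sig U -> X)
          (F : sig V -> sig U),
      plot X n U p -> is_open V -> smooth_map V (fun v => proj1_sig (F v)) ->
      plot X m V (fun v => p (F v))) /\
  (forall n (U : Rn n -> Prop) (p : sig U -> X), is_open U ->
      (forall x : sig U, exists (W : Rn n -> Prop) (HW : forall y, W y -> U y),
          is_open W /\ W (proj1_sig x) /\
          plot X n W (fun w => p (exist U (proj1_sig w) (HW _ (proj2_sig w))))) ->
      plot X n U p).

Definition smooth {X Y : DiffSp} (f : X -> Y) : Prop :=
  forall n U p, plot X n U p -> plot Y n U (fun u => f (p u)).

Definition sub_Rn (n : nat) (A : Rn n -> Prop) : DiffSp := {|
  carrier := sig A;
  plot := fun m U p => is_open U /\ smooth_map U (fun u => proj1_sig (p u))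
|}.

Definition R_diff : DiffSp := {|
  carrier := R;
  plot := fun m U p => is_open U /\ smooth_fun U p
|}.

Definition cube (n : nat) (x : Rn n) : Prop := forall i, 0 <= x i <= 1.
Definition cube_boundary (n : nat) (x : Rn n) : Prop :=
  cube n x /\ exists i, x i = 0 \/ x i = 1.

Definition In_cube (n : nat) : DiffSp := sub_Rn n (cube n).
Definition dIn_cube (n : nat) : DiffSp := sub_Rn n (cube_boundary n).

Definition bdry_incl (n : nat) (x : dIn_cube n) : In_cube n :=
  exist (cube n) (proj1_sig x) (proj1 (proj2_sig x)).

Definition Dopen (X : DiffSp) (A : X -> Prop) : Prop :=
  forall n U p, plot X n U p ->
    is_open (fun x : Rn n => exists h : U x, A (p (exist U x h))).

Definition Dclosed (X : DiffSp) (C : X -> Prop) : Prop :=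
  Dopen X (fun x => ~ C x).

Definition Dclosure (X : DiffSp) (A : X -> Prop) (x : X) : Prop :=
  forall C, Dclosed X C -> (forall y, A y -> C y) -> C x.

Definition supp {X : DiffSp} (psi : X -> R) : X -> Prop :=
  Dclosure X (fun x => psi x <> 0).

Definition locally_finite {X : DiffSp} {L : Type} (S : L -> X -> Prop) : Prop :=
  forall x : X, exists V : X -> Prop, Dopen X V /\ V x /\
    exists F : list L, forall l, (exists y, V y /\ S l y) -> In l F.

Definition sums_to_one {X : DiffSp} {L : Type} (psi : L -> X -> R) (x : X) : Prop :=
  exists F : list L, NoDup F /\ (forall l, psi l x <> 0 -> In l F) /\
    fold_right Rplus 0 (map (fun l => psi l x) F) = 1.

Definition partition_of_unity (X : DiffSp) {L : Type} (U : L -> X -> Prop)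
  (psi : L -> X -> R) : Prop :=
  (forall l, @smooth X R_diff (psi l)) /\
  (forall l x, 0 <= psi l x <= 1) /\
  (forall l x, supp (psi l) x -> U l x) /\
  locally_finite (fun l => supp (psi l)) /\
  (forall x, sums_to_one psi x).

(* An ordinal delta is represented by the well-ordered set of ordinals < delta. *)
Definition is_ordinal {O : Type} (lt : O -> O -> Prop) : Prop :=
  well_founded lt /\ (forall a, ~ lt a a) /\
  (forall a b c, lt a b -> lt b c -> lt a c) /\
  (forall a b, lt a b \/ a = b \/ lt b a).

Definition countable_ordinal {O : Type} (lt : O -> O -> Prop) : Prop :=
  is_ordinal lt /\ exists f : O -> nat, forall a b, f a = f b -> a = b.

Definition le {O : Type} (lt : O -> O -> Prop) (a b : O) : Prop := lt a b \/ a = b.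

Definition succ_of {O : Type} (lt : O -> O -> Prop) (a s : O) : Prop :=
  lt a s /\ forall c, lt a c -> le lt s c.

Definition is_limit {O : Type} (lt : O -> O -> Prop) (b : O) : Prop :=
  (exists a, lt a b) /\ ~ (exists a, succ_of lt a b).

Definition is_functor {O : Type} (lt : O -> O -> Prop) (Z : O -> DiffSp)
  (z : forall a b, le lt a b -> Z a -> Z b) : Prop :=
  (forall a, IsDiffeology (Z a)) /\
  (forall a b (h : le lt a b), smooth (z a b h)) /\
  (forall a (h : le lt a a) x, z a a h x = x) /\
  (forall a b c (h1 : le lt a b) (h2 : le lt b c) (h3 : le lt a c) x,
      z a c h3 x = z b c h2 (z a b h1 x)).

Definition is_colimit_below {O : Type} (lt : O -> O -> Prop) (Z : O -> DiffSp)
  (z : forall a b, le lt a b -> Z a -> Z b) (P : O -> Prop)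
  (Y : DiffSp) (g : forall a, P a -> Z a -> Y) : Prop :=
  IsDiffeology Y /\
  (forall a (ha : P a), smooth (g a ha)) /\
  (forall a b (ha : P a) (hb : P b) (h : le lt a b) x, g b hb (z a b h x) = g a ha x) /\
  (forall (W : DiffSp) (k : forall a, P a -> Z a -> W), IsDiffeology W ->
     (forall a (ha : P a), smooth (k a ha)) ->
     (forall a b (ha : P a) (hb : P b) (h : le lt a b) x, k b hb (z a b h x) = k a ha x) ->
     exists u : Y -> W, smooth u /\ (forall a (ha : P a) x, u (g a ha x) = k a ha x) /\
       forall u' : Y -> W, smooth u' -> (forall a (ha : P a) x, u' (g a ha x) = k a ha x) ->
         forall y, u' y = u y).

Definition is_delta_sequence {O : Type} (lt : O -> O -> Prop) (Z : O -> DiffSp)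
  (z : forall a b, le lt a b -> Z a -> Z b) : Prop :=
  is_functor lt Z z /\
  forall b, is_limit lt b ->
    is_colimit_below lt Z z (fun a => lt a b) (Z b) (fun a ha => z a b (or_introl ha)).

Definition is_pushout (n : nat) {A B : DiffSp} (phi : dIn_cube n -> A)
  (f : A -> B) (Phi : In_cube n -> B) : Prop :=
  smooth f /\ smooth Phi /\
  (forall x, f (phi x) = Phi (bdry_incl n x)) /\
  (forall (W : DiffSp) (g : A -> W) (h : In_cube n -> W), IsDiffeology W ->
     smooth g -> smooth h -> (forall x, g (phi x) = h (bdry_incl n x)) ->
     exists u : B -> W, smooth u /\ (forall a, u (f a) = g a) /\
       (forall c, u (Phi c) = h c) /\
       forall u' : B -> W, smooth u' -> (forall a, u' (f a) = g a) ->
         (forall c, u' (Phi c) = h c) -> forall y, u' y = u y).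

Definition smooth_cell_complex {O : Type} (lt : O -> O -> Prop) (Z : O -> DiffSp)
  (z : forall a b, le lt a b -> Z a -> Z b) (X : DiffSp) (iota : forall a, Z a -> X) : Prop :=
  is_delta_sequence lt Z z /\
  (forall a, (forall b, ~ lt b a) -> Z a -> False) /\
  is_colimit_below lt Z z (fun _ => True) X (fun a _ => iota a) /\
  (forall b s (hs : succ_of lt b s), exists (n : nat) (phi : dIn_cube n -> Z b)
       (Phi : In_cube n -> Z s),
     smooth phi /\ is_pushout n phi (z b s (or_introl (proj1 hs))) Phi).

(* Main.v *)
(** Smooth regularity plus a countable cover by compact cells give partitions of unity.

    For a point [x] of a [D]-open set [V] one builds a smooth [f] on [X] with [f x >= 1] and
    [{f >= 1/2}] inside [V], by recursion along the stages, starting at the cell whose interior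
    contains [x].  The closed condition [{f >= 1/2} c V] is what survives the induction: at limit
    stages it is automatic, and when a cube is attached, the function on its boundary is extended
    by transfinite interpolation; the extension violates the condition only on a compact subset of
    the open cube, where a large multiple of [prod x_i (1 - x_i)] is subtracted.  As there are
    countably many cells, countably many sets [{f > 1/2}] cover [X]; cutting each function off where
    an earlier one is large makes the family locally finite, and one normalises. *)

From Stdlib Require Import Reals List Lra Lia Classical ClassicalEpsilon.
From Stdlib Require Import FunctionalExtensionality PropExtensionality ProofIrrelevance.
From Stdlib Require Vectors.Fin Arith.Cantor FinFun.
From Coquelicot Require Import Coquelicot.
Require Import Defs.

(** * Finite-order differentiability on open domains *)

(** The universal properties describe smooth maps out of pushouts and colimits, not their D-open
    sets. A neighbourhood of a point in one stage would have to be prolonged through all later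
    cells. It is therefore carried as the set [{f > 1/2}] of a real function: functions prolong by
    the universal property with target [R_diff], and D-openness then comes for free.

    A condition on supports would be awkward in this recursion, because a D-closure in a colimit
    need not be the union of the D-closures in the stages. The inequality [1/2 <= f] is tested point
    by point, and every point comes from an earlier stage or from the new cube. The non-strict
    containment also leaves room at the end: a function that vanishes where [f <= 1/2] has its
    support inside [{f >= 1/2}].

    Differentiability is developed from the given [Ck] because [R_diff] must be shown to be a
    diffeology, and its composition axiom is the chain rule in several variables. *)

Definition asbool (P : Prop) : {P} + {~ P} := excluded_middle_informative P.

Lemma dep_choice_fun {A : Type} {B : A -> Type} (P : forall a, B a -> Prop) :
  (forall a, exists b, P a b) -> exists f : forall a, B a, forall a, P a (f a).
Proof.
  intros H.
  exists (fun a => proj1_sig (constructive_indefinite_description _ (H a))).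
  intros a. exact (proj2_sig (constructive_indefinite_description _ (H a))).
Qed.

Lemma sig_ext {A : Type} (P : A -> Prop) (x y : sig P) : proj1_sig x = proj1_sig y -> x = y.
Proof.
  destruct x as [x hx], y as [y hy]; simpl. intros ->. f_equal. apply proof_irrelevance.
Qed.

Fixpoint fin_list (n : nat) : list (Fin.t n) :=
  match n with
  | O => nil
  | S m => Fin.F1 :: map Fin.FS (fin_list m)
  end.

Lemma in_fin_list n (i : Fin.t n) : In i (fin_list n).
Proof.
  induction i; simpl; [now left|right]. now apply in_map.
Qed.

Lemma NoDup_fin_list n : NoDup (fin_list n).
Proof.
  induction n as [|n IH]; simpl; constructor.
  - rewrite in_map_iff. intros [x [H _]]. discriminate.
  - apply FinFun.Injective_map_NoDup; [|exact IH].
    intros a b H. now apply Fin.FS_inj.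
Qed.

(** The minimum of finitely many radii works, since [P] passes to smaller ones. This reduces
    sup-norm estimates to single coordinates. *)
Lemma fin_uniform_radius {n} (P : Fin.t n -> R -> Prop) :
  (forall j a b, 0 < b <= a -> P j a -> P j b) ->
  (forall j, exists d, 0 < d /\ P j d) -> exists d, 0 < d /\ forall j, P j d.
Proof.
  intros Hm H.
  assert (G : forall l : list (Fin.t n), exists d, 0 < d /\ forall j, In j l -> P j d).
  { induction l as [|i l [d [Hd IH]]].
    - exists 1. split; [lra|]. intros j [].
    - destruct (H i) as [e [He Hi]]. exists (Rmin d e).
      assert (M := Rmin_pos d e Hd He).
      split; [exact M|]. intros j [<-|Hj].
      + apply Hm with e; [|exact Hi]. split; [exact M|apply Rmin_r].
      + apply Hm with d; [|now apply IH]. split; [exact M|apply Rmin_l]. }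
  destruct (G (fin_list n)) as [d [Hd K]]. exists d. split; [exact Hd|].
  intros j. apply K, in_fin_list.
Qed.

Section OpenDomain.
Context {n : nat} {U : Rn n -> Prop}.

(** The neighbourhood filter of [x] in [U]: continuity becomes [filterlim], so limit laws for
    filters give continuity of sums, products and composites. *)
Definition nb (x : sig U) (P : sig U -> Prop) : Prop :=
  exists del, 0 < del /\ forall y : sig U,
    (forall j, Rabs (proj1_sig y j - proj1_sig x j) < del) -> P y.

Global Instance nb_filter (x : sig U) : Filter (nb x).
Proof.
  split.
  - exists 1. split; [lra|easy].
  - intros P Q [d [Hd HP]] [e [He HQ]]. exists (Rmin d e).
    split; [now apply Rmin_pos|]. intros y Hy.
    split; [apply HP|apply HQ]; intros j; eapply Rlt_le_trans; try apply Hy.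
    + apply Rmin_l.
    + apply Rmin_r.
  - intros P Q HPQ [d [Hd HP]]. exists d. split; [easy|]. intros y Hy. now apply HPQ, HP.
Qed.

Lemma cont_on_filterlim (g : sig U -> R) :
  cont_on U g <-> forall x, filterlim g (nb x) (locally (g x)).
Proof.
  split.
  - intros H x P [eps HP]. destruct (H x eps (cond_pos eps)) as [d [Hd K]].
    exists d. split; [exact Hd|]. intros y Hy. apply HP, K, Hy.
  - intros H x eps He.
    destruct (H x _ (locally_ball (g x) (mkposreal eps He))) as [d [Hd K]].
    exists d. split; [exact Hd|]. intros y Hy. exact (K y Hy).
Qed.

Lemma cont_plus (f g : sig U -> R) :
  cont_on U f -> cont_on U g -> cont_on U (fun x => f x + g x).
Proof.
  rewrite !cont_on_filterlim. intros Hf Hg x.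
  exact (filterlim_comp_2 f g Rplus (Hf x) (Hg x) (filterlim_plus (f x) (g x))).
Qed.

Lemma cont_mult (f g : sig U -> R) :
  cont_on U f -> cont_on U g -> cont_on U (fun x => f x * g x).
Proof.
  rewrite !cont_on_filterlim. intros Hf Hg x.
  exact (filterlim_comp_2 f g Rmult (Hf x) (Hg x) (filterlim_mult (f x) (g x))).
Qed.

Lemma cont_comp1 (f : sig U -> R) (h : R -> R) :
  cont_on U f -> (forall x, continuity_pt h (f x)) -> cont_on U (fun x => h (f x)).
Proof.
  rewrite !cont_on_filterlim. intros Hf Hh x.
  eapply filterlim_comp; [apply Hf|]. apply continuity_pt_filterlim, Hh.
Qed.

Lemma cont_const (c : R) : cont_on U (fun _ => c).
Proof.
  intros x eps He. exists 1. split; [lra|]. intros y _. now rewrite Rminus_diag, Rabs_R0.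
Qed.

Lemma shift_0 (i : Fin.t n) (x : Rn n) : shift i 0 x = x.
Proof.
  apply functional_extensionality. intros j. unfold shift.
  destruct (Fin.eq_dec i j); ring.
Qed.

Lemma shift_close (i : Fin.t n) t (x : Rn n) eps :
  Rabs t < eps -> forall j, Rabs (shift i t x j - x j) < eps.
Proof.
  intros H j. unfold shift. destruct (Fin.eq_dec i j).
  - replace (x j + t - x j) with t by ring. exact H.
  - rewrite Rminus_diag, Rabs_R0. assert (K := Rabs_pos t). lra.
Qed.

(* Staying at [x] outside [U] is harmless, since derivatives at 0 only see small [t]. *)
Definition shift_in (i : Fin.t n) (x : sig U) (t : R) : sig U :=
  match asbool (U (shift i t (proj1_sig x))) with
  | left h => exist U _ h
  | right _ => x
  end.

Lemma shift_in_eq i x t : U (shift i t (proj1_sig x)) ->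
  proj1_sig (shift_in i x t) = shift i t (proj1_sig x).
Proof. intros H. unfold shift_in. destruct asbool; easy. Qed.

Lemma shift_in_0 i x : shift_in i x 0 = x.
Proof.
  apply sig_ext. rewrite shift_in_eq; rewrite shift_0; [easy|]. exact (proj2_sig x).
Qed.

(** Along the line through [x] the partial derivative is a one-variable derivative at 0, so the
    known rules for sums, products and composites apply. Openness keeps small shifts inside [U]. *)
Lemma has_partial_iff (HU : is_open U) (g : sig U -> R) i x l :
  has_partial U g i x l <-> derivable_pt_lim (fun t => g (shift_in i x t)) 0 l.
Proof.
  split.
  - intros H eps He. destruct (H eps He) as [d [Hd K]].
    destruct (HU _ (proj2_sig x)) as [e [He' Ke]].
    exists (mkposreal _ (Rmin_pos d e Hd He')). simpl. intros t Ht Htd.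
    rewrite Rplus_0_l, shift_in_0.
    assert (h : U (shift i t (proj1_sig x))).
    { apply Ke, shift_close. eapply Rlt_le_trans; [exact Htd|apply Rmin_r]. }
    replace (shift_in i x t) with (exist U _ h).
    + apply K; [exact Ht|]. eapply Rlt_le_trans; [exact Htd|apply Rmin_l].
    + apply sig_ext. now rewrite shift_in_eq.
  - intros H eps He. destruct (H eps He) as [d K].
    exists d. split; [apply cond_pos|]. intros t h Ht Htd.
    specialize (K t Ht Htd). rewrite Rplus_0_l, shift_in_0 in K.
    replace (exist U _ h) with (shift_in i x t); [exact K|].
    apply sig_ext. now rewrite shift_in_eq.
Qed.

Lemma has_partial_unique (HU : is_open U) (g : sig U -> R) i x l l' :
  has_partial U g i x l -> has_partial U g i x l' -> l = l'.
Proof. rewrite !has_partial_iff by exact HU. apply uniqueness_limite. Qed.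

Lemma partial_plus (HU : is_open U) (f g : sig U -> R) i x l l' :
  has_partial U f i x l -> has_partial U g i x l' ->
  has_partial U (fun y => f y + g y) i x (l + l').
Proof.
  rewrite !has_partial_iff by exact HU. intros Hf Hg. exact (derivable_pt_lim_plus _ _ _ _ _ Hf Hg).
Qed.

Lemma partial_mult (HU : is_open U) (f g : sig U -> R) i x l l' :
  has_partial U f i x l -> has_partial U g i x l' ->
  has_partial U (fun y => f y * g y) i x (l * g x + f x * l').
Proof.
  rewrite !has_partial_iff by exact HU. intros Hf Hg.
  assert (K := derivable_pt_lim_mult _ _ _ _ _ Hf Hg). cbv beta in K.
  rewrite shift_in_0 in K. exact K.
Qed.

Lemma partial_comp1 (HU : is_open U) (f : sig U -> R) (h : R -> R) i x l l' :
  has_partial U f i x l -> derivable_pt_lim h (f x) l' ->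
  has_partial U (fun y => h (f y)) i x (l' * l).
Proof.
  rewrite !has_partial_iff by exact HU. intros Hf Hh.
  apply (derivable_pt_lim_comp (fun t => f (shift_in i x t)) h); [exact Hf|].
  now rewrite shift_in_0.
Qed.

Lemma partial_const i (x : sig U) c : has_partial U (fun _ => c) i x 0.
Proof.
  intros eps He. exists 1. split; [lra|]. intros t _ Ht _.
  replace ((c - c) / t - 0) with 0 by (field; exact Ht). now rewrite Rabs_R0.
Qed.

Lemma Ck_cont k (g : sig U -> R) : Ck U k g -> cont_on U g.
Proof. destruct k; [easy|now intros [H _]]. Qed.

Lemma Ck_pred k : forall g : sig U -> R, Ck U (S k) g -> Ck U k g.
Proof.
  induction k as [|k IH]; intros g [Hc H]; [exact Hc|]. split; [exact Hc|].
  intros i. destruct (H i) as [dg [H1 H2]]. exists dg. split; [exact H1|]. now apply IH.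
Qed.

Lemma Ck_const k : forall c, Ck U k (fun _ => c).
Proof.
  induction k as [|k IH]; intros c; [apply cont_const|]. split; [apply cont_const|].
  intros i. exists (fun _ => 0). split; [|apply IH]. intros x. apply partial_const.
Qed.

Lemma Ck_plus (HU : is_open U) k : forall f g : sig U -> R,
  Ck U k f -> Ck U k g -> Ck U k (fun x => f x + g x).
Proof.
  induction k as [|k IH]; intros f g; [apply cont_plus|].
  intros [Hf Df] [Hg Dg]. split; [now apply cont_plus|]. intros i.
  destruct (Df i) as [df [Pf Kf]], (Dg i) as [dg [Pg Kg]].
  exists (fun x => df x + dg x). split; [|now apply IH].
  intros x. now apply partial_plus.
Qed.

Lemma Ck_mult (HU : is_open U) k : forall f g : sig U -> R,
  Ck U k f -> Ck U k g -> Ck U k (fun x => f x * g x).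
Proof.
  induction k as [|k IH]; intros f g; [apply cont_mult|].
  intros HHf HHg. assert (Lf := Ck_pred _ _ HHf). assert (Lg := Ck_pred _ _ HHg).
  destruct HHf as [Hf Df], HHg as [Hg Dg]. split; [now apply cont_mult|]. intros i.
  destruct (Df i) as [df [Pf Kf]], (Dg i) as [dg [Pg Kg]].
  exists (fun x => df x * g x + f x * dg x). split.
  - intros x. now apply partial_mult.
  - apply Ck_plus; [exact HU| |]; now apply IH.
Qed.

(** A family [F] closed under differentiation on [D] stands in for smoothness of [h]. The induction
    on [k] treats all members of [F] at once, because the derivative of [h] is another member. *)
Lemma Ck_comp1 (HU : is_open U) (D : R -> Prop) (F : (R -> R) -> Prop) :
  (forall h, F h -> exists h', F h' /\ forall x, D x -> derivable_pt_lim h x (h' x)) ->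
  forall k (f : sig U -> R) h, F h -> (forall x, D (f x)) -> Ck U k f ->
  Ck U k (fun x => h (f x)).
Proof.
  intros HF.
  assert (C : forall f : sig U -> R, forall h, F h -> (forall x, D (f x)) -> cont_on U f ->
    cont_on U (fun x => h (f x))).
  { intros f h Hh HD Hf. destruct (HF h Hh) as [h' [_ Hd]].
    apply cont_comp1; [exact Hf|]. intros x.
    apply derivable_continuous_pt. exists (h' (f x)). apply Hd, HD. }
  induction k as [|k IH]; intros f h Hh HD Hf; [now apply C|].
  assert (Lf := Ck_pred _ _ Hf). destruct Hf as [Hf Df]. split; [now apply C|].
  intros i. destruct (Df i) as [df [Pf Kf]], (HF h Hh) as [h' [Hh' Hd]].
  exists (fun x => h' (f x) * df x). split.
  - intros x. apply partial_comp1; [exact HU|apply Pf|apply Hd, HD].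
  - apply Ck_mult; [exact HU| |exact Kf]. now apply IH.
Qed.

Lemma Ck_sum (HU : is_open U) k {I : Type} (l : list I) (g : I -> sig U -> R) :
  (forall i, In i l -> Ck U k (g i)) ->
  Ck U k (fun x => fold_right Rplus 0 (map (fun i => g i x) l)).
Proof.
  induction l as [|i l IH]; simpl; intros H; [apply Ck_const|].
  apply Ck_plus; [exact HU|apply H; now left|]. apply IH. intros j Hj. apply H. now right.
Qed.

Lemma cont_proj (j : Fin.t n) : cont_on U (fun x => proj1_sig x j).
Proof. intros x eps He. exists eps. split; [exact He|]. intros y Hy. apply Hy. Qed.

Lemma smooth_proj (j : Fin.t n) : smooth_fun U (fun x => proj1_sig x j).
Proof.
  intros [|k]; [apply cont_proj|]. split; [apply cont_proj|]. intros i.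
  exists (fun _ => if Fin.eq_dec i j then 1 else 0). split; [|apply Ck_const].
  intros x eps He. exists 1. split; [lra|]. intros t h Ht _. simpl. unfold shift.
  assert (E : forall a b, a = b -> Rabs (a - b) < eps).
  { intros a b ->. now rewrite Rminus_diag, Rabs_R0. }
  destruct (Fin.eq_dec i j); apply E; now field.
Qed.

End OpenDomain.

Definition restrict {n} {U W : Rn n -> Prop} (HW : forall y, W y -> U y) (w : sig W) : sig U :=
  exist U (proj1_sig w) (HW _ (proj2_sig w)).

Lemma cont_on_local {n} (U : Rn n -> Prop) (g : sig U -> R) :
  (forall x : sig U, exists (W : Rn n -> Prop) (HW : forall y, W y -> U y),
     is_open W /\ W (proj1_sig x) /\ cont_on W (fun w => g (restrict HW w))) ->
  cont_on U g.
Proof.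
  intros H x eps He. destruct (H x) as [W [HW [Wo [Wx Hg]]]].
  destruct (Hg (exist W _ Wx) eps He) as [d [Hd K]]. destruct (Wo _ Wx) as [e [Hee Ke]].
  exists (Rmin d e). split; [now apply Rmin_pos|]. intros y Hy.
  assert (Wy : W (proj1_sig y)).
  { apply Ke. intros j. eapply Rlt_le_trans; [apply Hy|apply Rmin_r]. }
  specialize (K (exist W _ Wy)).
  replace x with (restrict HW (exist W _ Wx)) by now apply sig_ext.
  replace y with (restrict HW (exist W _ Wy)) by now apply sig_ext.
  apply K. intros j. eapply Rlt_le_trans; [apply Hy|apply Rmin_l].
Qed.

Lemma partial_local {n} (U W : Rn n -> Prop) (HW : forall y, W y -> U y) (g : sig U -> R) i
  (w : sig W) l : is_open W ->
  has_partial U g i (restrict HW w) l <-> has_partial W (fun w => g (restrict HW w)) i w l.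
Proof.
  intros Wo. split; intros H eps He; destruct (H eps He) as [d [Hd K]].
  - exists d. split; [exact Hd|]. intros t h. exact (K t (HW _ h)).
  - destruct (Wo _ (proj2_sig w)) as [e [Hee Ke]].
    exists (Rmin d e). split; [now apply Rmin_pos|]. intros t h Ht Htd.
    assert (h' : W (shift i t (proj1_sig w))).
    { apply Ke, shift_close. eapply Rlt_le_trans; [exact Htd|apply Rmin_r]. }
    specialize (K t h' Ht). replace (exist U _ h) with (restrict HW (exist W _ h'))
      by now apply sig_ext.
    apply K. eapply Rlt_le_trans; [exact Htd|apply Rmin_l].
Qed.

Lemma Ck_local {n} (U : Rn n -> Prop) (HU : is_open U) k : forall g : sig U -> R,
  (forall x : sig U, exists (W : Rn n -> Prop) (HW : forall y, W y -> U y),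
     is_open W /\ W (proj1_sig x) /\ Ck W k (fun w => g (restrict HW w))) ->
  Ck U k g.
Proof.
  induction k as [|k IH]; intros g H; [now apply cont_on_local|]. split.
  - apply cont_on_local. intros x. destruct (H x) as [W [HW [Wo [Wx Hg]]]].
    exists W, HW. repeat split; try easy. exact (Ck_cont _ _ Hg).
  - intros i.
    (* The local derivatives must come from one function on [U]: it is chosen point by point, and
       uniqueness of partial derivatives identifies it with each local one. *)
    assert (P : forall x, exists l, has_partial U g i x l).
    { intros x. destruct (H x) as [W [HW [Wo [Wx [_ Hg]]]]].
      destruct (Hg i) as [dg [D _]]. exists (dg (exist W _ Wx)).
      assert (E : restrict HW (exist W _ Wx) = x) by now apply sig_ext.
      specialize (D (exist W _ Wx)). apply (partial_local U W HW) in D; [|exact Wo].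
      now rewrite E in D. }
    destruct (dep_choice_fun _ P) as [dg D]. exists dg. split; [exact D|].
    apply IH. intros x. destruct (H x) as [W [HW [Wo [Wx [_ Hg]]]]].
    exists W, HW. repeat split; try easy.
    destruct (Hg i) as [dg' [D' C']].
    replace (fun w => dg (restrict HW w)) with dg'; [exact C'|].
    apply functional_extensionality. intros w.
    apply (has_partial_unique HU g i (restrict HW w)); [|apply D].
    apply partial_local; [exact Wo|apply D'].
Qed.

(** * Differentiability and the chain rule in R^n *)

Definition rsum {I : Type} (l : list I) (a : I -> R) : R := fold_right Rplus 0 (map a l).

Lemma rsum_abs_le {I} (l : list I) a b : (forall i, In i l -> Rabs (a i) <= b i) ->
  Rabs (rsum l a) <= rsum l b.
Proof.
  unfold rsum. induction l as [|i l IH]; simpl; intros H; [rewrite Rabs_R0; lra|].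
  eapply Rle_trans; [apply Rabs_triang|]. apply Rplus_le_compat; [apply H; now left|].
  apply IH. intros j Hj. apply H. now right.
Qed.

Lemma rsum_minus {I} (l : list I) a b : rsum l (fun i => a i - b i) = rsum l a - rsum l b.
Proof. unfold rsum. induction l as [|i l IH]; simpl; [ring|]. rewrite IH. ring. Qed.

Lemma rsum_scal {I} (l : list I) c a : rsum l (fun i => c * a i) = c * rsum l a.
Proof. unfold rsum. induction l as [|i l IH]; simpl; [ring|]. rewrite IH. ring. Qed.

Lemma rsum_ext {I} (l : list I) a b : (forall i, In i l -> a i = b i) -> rsum l a = rsum l b.
Proof.
  unfold rsum. intros H. f_equal. apply map_ext_in, H.
Qed.

Lemma rsum_nonneg {I} (l : list I) a : (forall i, In i l -> 0 <= a i) -> 0 <= rsum l a.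
Proof.
  unfold rsum. induction l as [|i l IH]; simpl; intros H; [lra|].
  apply Rplus_le_le_0_compat; [apply H; now left|]. apply IH. intros j Hj. apply H. now right.
Qed.

Lemma rsum_term_le {I} (l : list I) a i : (forall i, In i l -> 0 <= a i) -> In i l -> a i <= rsum l a.
Proof.
  unfold rsum. induction l as [|k l IH]; simpl; intros H; [easy|].
  assert (K : 0 <= rsum l a) by (apply rsum_nonneg; auto). unfold rsum in K.
  assert (K' := H k (or_introl eq_refl)).
  intros [<-|Hi]; [lra|]. specialize (IH (fun j Hj => H j (or_intror Hj)) Hi). lra.
Qed.

Lemma derivable_shift_in {n} (U : Rn n -> Prop) (HU : is_open U) (g : sig U -> R) i
  (w : sig U) t l : U (shift i t (proj1_sig w)) -> has_partial U g i (shift_in i w t) l ->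
  derivable_pt_lim (fun t => g (shift_in i w t)) t l.
Proof.
  intros Ut P ep Hep. destruct (P ep Hep) as [d1 [Hd1 P1]].
  destruct (HU _ Ut) as [d2 [Hd2 P2]].
  exists (mkposreal _ (Rmin_pos d1 d2 Hd1 Hd2)). simpl. intros h Hh Hhd.
  assert (Sh : shift i (t + h) (proj1_sig w) = shift i h (proj1_sig (shift_in i w t))).
  { rewrite shift_in_eq by exact Ut. apply functional_extensionality. intros j.
    unfold shift. destruct (Fin.eq_dec i j); ring. }
  assert (Uh : U (shift i h (proj1_sig (shift_in i w t)))).
  { rewrite shift_in_eq by exact Ut. apply P2, shift_close.
    eapply Rlt_le_trans; [exact Hhd|apply Rmin_r]. }
  replace (shift_in i w (t + h)) with (exist U _ Uh).
  - apply P1; [exact Hh|]. eapply Rlt_le_trans; [exact Hhd|apply Rmin_l].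
  - apply sig_ext. rewrite shift_in_eq; now rewrite Sh.
Qed.

Definition mix {n} (l : list (Fin.t n)) (x y : Rn n) : Rn n :=
  fun j => if in_dec Fin.eq_dec j l then y j else x j.

(* Moving from [x] to [y] one coordinate at a time, each step is controlled by the mean value theorem. *)
Lemma C1_differentiable {n} (U : Rn n -> Prop) (HU : is_open U) (g : sig U -> R)
  (dg : Fin.t n -> sig U -> R) :
  (forall i x, has_partial U g i x (dg i x)) -> (forall i, cont_on U (dg i)) ->
  forall x eps, 0 < eps -> exists del, 0 < del /\
    forall y : sig U, (forall j, Rabs (proj1_sig y j - proj1_sig x j) < del) ->
      Rabs (g y - g x - rsum (fin_list n) (fun j => dg j x * (proj1_sig y j - proj1_sig x j)))
      <= eps * rsum (fin_list n) (fun j => Rabs (proj1_sig y j - proj1_sig x j)).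
Proof.
  intros HD HC x eps He.
  destruct (fin_uniform_radius (fun j d => forall y : sig U,
     (forall j, Rabs (proj1_sig y j - proj1_sig x j) < d) -> Rabs (dg j y - dg j x) < eps))
    as [d [Hd K]].
  { intros j a b Hab H y Hy. apply H. intros i. eapply Rlt_le_trans; [apply Hy|apply Hab]. }
  { intros j. exact (HC j x eps He). }
  destruct (HU _ (proj2_sig x)) as [e [Hee Ke]].
  exists (Rmin d e). split; [now apply Rmin_pos|]. intros y Hy.
  assert (Yd : forall j, Rabs (proj1_sig y j - proj1_sig x j) < d).
  { intros j. eapply Rlt_le_trans; [apply Hy|apply Rmin_l]. }
  assert (Ye : forall j, Rabs (proj1_sig y j - proj1_sig x j) < e).
  { intros j. eapply Rlt_le_trans; [apply Hy|apply Rmin_r]. }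
  clear Hy.
  assert (B : forall w : Rn n, (forall j, Rabs (w j - proj1_sig x j) <= Rabs (proj1_sig y j - proj1_sig x j))
     -> U w).
  { intros w Hw. apply Ke. intros j. eapply Rle_lt_trans; [apply Hw|apply Ye]. }
  assert (Mx : forall l j, Rabs (mix l (proj1_sig x) (proj1_sig y) j - proj1_sig x j)
     <= Rabs (proj1_sig y j - proj1_sig x j)).
  { intros l j. unfold mix. destruct in_dec; [lra|]. rewrite Rminus_diag, Rabs_R0. apply Rabs_pos. }
  (* [l] lists the coordinates already moved; [NoDup] guarantees that the next coordinate still has
     its value at [x]. *)
  assert (G : forall l, NoDup l ->
     Rabs (g (exist U _ (B _ (Mx l))) - g x - rsum l (fun j => dg j x * (proj1_sig y j - proj1_sig x j)))
      <= eps * rsum l (fun j => Rabs (proj1_sig y j - proj1_sig x j))).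
  { induction l as [|i l IH]; intros Hl.
    - unfold rsum; simpl. replace (exist U _ _) with x.
      + rewrite !Rminus_diag, Rabs_R0. lra.
      + apply sig_ext. simpl. apply functional_extensionality. reflexivity.
    - inversion Hl as [|? ? Hi Hl']; subst. specialize (IH Hl').
      set (w := exist U _ (B _ (Mx l))) in *. set (w' := exist U _ (B _ (Mx (i :: l)))).
      set (s := proj1_sig y i - proj1_sig x i).
      assert (Wi : proj1_sig w i = proj1_sig x i).
      { simpl. unfold mix. destruct in_dec; easy. }
      (* The increment [s] may have either sign, hence the interval between [Rmin 0 s] and
         [Rmax 0 s]. The whole segment stays in the box around [x]. *)
      assert (Bt : forall t, Rmin 0 s <= t <= Rmax 0 s -> forall j,
         Rabs (shift i t (proj1_sig w) j - proj1_sig x j) <= Rabs (proj1_sig y j - proj1_sig x j)).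
      { intros t Ht j. unfold shift. destruct (Fin.eq_dec i j) as [<-|Hij].
        - rewrite Wi. fold s. replace (proj1_sig x i + t - proj1_sig x i) with t by ring.
          revert Ht. unfold Rmin, Rmax. destruct (Rle_dec 0 s); intros Ht;
            unfold Rabs; destruct (Rcase_abs t), (Rcase_abs s); lra.
        - apply Mx. }
      assert (Ew : shift_in i w s = w').
      { assert (Us : U (shift i s (proj1_sig w))).
        { apply B, Bt. split; [apply Rmin_r|apply Rmax_r]. }
        apply sig_ext. rewrite shift_in_eq by exact Us.
        apply functional_extensionality. intros j. unfold shift, w, w', mix.
        cbn [proj1_sig].
        destruct (in_dec Fin.eq_dec j l) as [Hj|Hj], (in_dec Fin.eq_dec j (i :: l)) as [Q|Q];
          destruct (Fin.eq_dec i j) as [<-|Hij]; simpl in Q; unfold s; try tauto; ring. }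
      destruct (MVT_gen (fun t => g (shift_in i w t)) 0 s (fun t => dg i (shift_in i w t)))
        as [c [Hc E]].
      { intros t Ht. apply is_derive_Reals, derivable_shift_in; [exact HU| |apply HD].
        apply B, Bt. lra. }
      { intros t Ht. apply derivable_continuous_pt. exists (dg i (shift_in i w t)).
        apply derivable_shift_in; [exact HU| |apply HD]. now apply B, Bt. }
      rewrite Ew, shift_in_0 in E. fold w in IH.
      assert (Uc : U (shift i c (proj1_sig w))) by (apply B, Bt; lra).
      assert (Kc : Rabs (dg i (shift_in i w c) - dg i x) < eps).
      { apply K. intros j. rewrite shift_in_eq by exact Uc.
        eapply Rle_lt_trans; [now apply Bt|apply Yd]. }
      unfold rsum in *. cbn [map fold_right]. fold s.
      match goal with |- Rabs (_ - _ - (_ + ?S)) <= _ * (_ + ?T) => set (S1 := S) in *; set (S2 := T) in * end.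
      replace (g w' - g x - (dg i x * s + S1)) with
        ((dg i (shift_in i w c) - dg i x) * s + (g w - g x - S1)).
      + eapply Rle_trans; [apply Rabs_triang|]. rewrite Rabs_mult.
        assert (0 <= Rabs s) by apply Rabs_pos. nra.
      + replace (g w') with (g w + dg i (shift_in i w c) * (s - 0)) by lra. ring. }
  specialize (G _ (NoDup_fin_list n)).
  replace (exist U _ _) with y in G; [exact G|].
  apply sig_ext. simpl. apply functional_extensionality. intros j. unfold mix.
  destruct in_dec as [H|H]; [easy|]. exfalso. apply H, in_fin_list.
Qed.

Lemma continuous_coords {n m} {U : Rn n -> Prop} {V : Rn m -> Prop} (F : sig V -> sig U) :
  (forall j, cont_on V (fun v => proj1_sig (F v) j)) ->
  forall v del, 0 < del -> nb v (fun w => forall j, Rabs (proj1_sig (F w) j - proj1_sig (F v) j) < del).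
Proof.
  intros H v del Hd.
  destruct (fin_uniform_radius (fun j d => forall y : sig V,
     (forall j, Rabs (proj1_sig y j - proj1_sig v j) < d) ->
     Rabs (proj1_sig (F y) j - proj1_sig (F v) j) < del)) as [d [Hd' K]].
  { intros j a b Hab K y Hy. apply K. intros i. eapply Rlt_le_trans; [apply Hy|apply Hab]. }
  { intros j. exact (H j v del Hd). }
  exists d. split; [exact Hd'|]. intros y Hy j. now apply K.
Qed.

Lemma cont_comp {n m} {U : Rn n -> Prop} {V : Rn m -> Prop} (F : sig V -> sig U) (g : sig U -> R) :
  cont_on U g -> (forall j, cont_on V (fun v => proj1_sig (F v) j)) ->
  cont_on V (fun v => g (F v)).
Proof.
  intros Hg HF v eps He. destruct (Hg (F v) eps He) as [d [Hd K]].
  destruct (continuous_coords F HF v d Hd) as [d' [Hd' K']].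
  exists d'. split; [exact Hd'|]. intros y Hy. now apply K, K'.
Qed.

Lemma partial_comp {n m} {U : Rn n -> Prop} {V : Rn m -> Prop} (HU : is_open U) (HV : is_open V)
  (F : sig V -> sig U) (g : sig U -> R) (dg : Fin.t n -> sig U -> R) i v (dF : Fin.t n -> R) :
  (forall i x, has_partial U g i x (dg i x)) -> (forall i, cont_on U (dg i)) ->
  (forall j, cont_on V (fun v => proj1_sig (F v) j)) ->
  (forall j, has_partial V (fun v => proj1_sig (F v) j) i v (dF j)) ->
  has_partial V (fun v => g (F v)) i v (rsum (fin_list n) (fun j => dg j (F v) * dF j)).
Proof.
  intros HD HC HF HdF eps He.
  set (S := rsum (fin_list n) (fun j => Rabs (dg j (F v)) + (Rabs (dF j) + 1))).
  assert (HS : 0 <= S).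
  { apply rsum_nonneg. intros j _. assert (A := Rabs_pos (dg j (F v))). assert (B := Rabs_pos (dF j)). lra. }
  (* The bound [e <= 1] gives [|q j| <= |dF j| + 1] for the difference quotients [q j] of [F]. The
     linearisation error of [g] and the error of these quotients then add up to at most
     [e * S < eps]; [S + 1] avoids a zero denominator. *)
  set (e := Rmin 1 (eps / (S + 1))).
  assert (He1 : 0 < eps / (S + 1)) by (apply Rdiv_lt_0_compat; lra).
  assert (Hee : 0 < e) by (apply Rmin_pos; lra).
  assert (HeS : e * S < eps).
  { apply Rle_lt_trans with (eps / (S + 1) * S).
    - apply Rmult_le_compat_r; [exact HS|apply Rmin_r].
    - apply Rlt_le_trans with (eps / (S + 1) * (S + 1)).
      + apply Rmult_lt_compat_l; lra.
      + right. field. lra. }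
  destruct (C1_differentiable U HU g dg HD HC (F v) e Hee) as [d1 [Hd1 K1]].
  destruct (continuous_coords F HF v d1 Hd1) as [d2 [Hd2 K2]].
  destruct (fin_uniform_radius (fun j d => forall t (h : V (shift i t (proj1_sig v))), t <> 0 ->
     Rabs t < d -> Rabs ((proj1_sig (F (exist V _ h)) j - proj1_sig (F v) j) / t - dF j) < e))
    as [d3 [Hd3 K3]].
  { intros j a b Hab K t h Ht Htd. apply K; [exact Ht|lra]. }
  { intros j. exact (HdF j e Hee). }
  exists (Rmin d2 d3). split; [now apply Rmin_pos|]. intros t h Ht Htd.
  assert (T2 : Rabs t < d2) by (eapply Rlt_le_trans; [exact Htd|apply Rmin_l]).
  assert (T3 : Rabs t < d3) by (eapply Rlt_le_trans; [exact Htd|apply Rmin_r]).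
  set (y := F (exist V _ h)) in *. set (x := F v) in *.
  assert (Y : forall j, Rabs (proj1_sig y j - proj1_sig x j) < d1).
  { apply K2. intros j. now apply shift_close. }
  specialize (K1 y Y).
  set (q := fun j => (proj1_sig y j - proj1_sig x j) / t).
  assert (Q : forall j, Rabs (q j - dF j) < e) by (intros j; now apply K3).
  assert (Qd : forall j, proj1_sig y j - proj1_sig x j = t * q j) by (intros j; unfold q; now field).
  assert (E : rsum (fin_list n) (fun j => dg j x * (proj1_sig y j - proj1_sig x j))
     = t * rsum (fin_list n) (fun j => dg j x * q j)).
  { rewrite <- rsum_scal. apply rsum_ext. intros j _. rewrite Qd. ring. }
  assert (E' : rsum (fin_list n) (fun j => Rabs (proj1_sig y j - proj1_sig x j))
     = Rabs t * rsum (fin_list n) (fun j => Rabs (q j))).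
  { rewrite <- rsum_scal. apply rsum_ext. intros j _. now rewrite Qd, Rabs_mult. }
  assert (K4 : Rabs (g y - g x - t * rsum (fin_list n) (fun j => dg j x * q j))
     <= e * (Rabs t * rsum (fin_list n) (fun j => Rabs (q j)))).
  { rewrite <- E, <- E'. exact K1. }
  assert (A1 : Rabs ((g y - g x) / t - rsum (fin_list n) (fun j => dg j x * q j))
     <= e * rsum (fin_list n) (fun j => Rabs (q j))).
  { assert (Tp := Rabs_pos_lt t Ht). apply Rmult_le_reg_l with (Rabs t); [exact Tp|].
    rewrite <- Rabs_mult.
    replace (t * ((g y - g x) / t - rsum (fin_list n) (fun j => dg j x * q j)))
      with (g y - g x - t * rsum (fin_list n) (fun j => dg j x * q j)) by (now field).
    lra. }
  assert (A2 : Rabs (rsum (fin_list n) (fun j => dg j x * q j - dg j x * dF j))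
     <= rsum (fin_list n) (fun j => e * Rabs (dg j x))).
  { apply rsum_abs_le. intros j _. rewrite <- Rmult_minus_distr_l, Rabs_mult.
    assert (Z := Rabs_pos (dg j x)). specialize (Q j). nra. }
  rewrite rsum_minus, rsum_scal in A2.
  assert (A3 : rsum (fin_list n) (fun j => Rabs (q j)) <= rsum (fin_list n) (fun j => Rabs (dF j) + 1)).
  { apply Rle_trans with (Rabs (rsum (fin_list n) (fun j => Rabs (q j)))); [apply Rle_abs|].
    apply rsum_abs_le. intros j _. rewrite Rabs_Rabsolu.
    assert (Z := Rabs_triang (q j - dF j) (dF j)). replace (q j - dF j + dF j) with (q j) in Z by ring.
    specialize (Q j). assert (e <= 1) by apply Rmin_l. lra. }
  assert (ES : S = rsum (fin_list n) (fun j => Rabs (dg j x)) + rsum (fin_list n) (fun j => Rabs (dF j) + 1)).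
  { unfold S, rsum. clear. induction (fin_list n) as [|j l IH]; simpl; [ring|]. rewrite IH. ring. }
  assert (Z := Rabs_triang ((g y - g x) / t - rsum (fin_list n) (fun j => dg j x * q j))
     (rsum (fin_list n) (fun j => dg j x * q j) - rsum (fin_list n) (fun j => dg j x * dF j))).
  match type of Z with Rabs ?a <= _ => replace a with
    ((g y - g x) / t - rsum (fin_list n) (fun j => dg j x * dF j)) in Z by ring end.
  apply (Rmult_le_compat_l e) in A3; [|lra]. rewrite ES in HeS. lra.
Qed.

(** By the chain rule the derivative is a sum of products of [dg j] composed with [F] and partial
    derivatives of [F]. The induction hypothesis applies to the first factors. *)
Lemma Ck_comp {n m} {U : Rn n -> Prop} {V : Rn m -> Prop} (HU : is_open U) (HV : is_open V)
  (F : sig V -> sig U) k : forall g : sig U -> R,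
  Ck U k g -> (forall j, Ck V k (fun v => proj1_sig (F v) j)) -> Ck V k (fun v => g (F v)).
Proof.
  induction k as [|k IH]; intros g Hg HF; [now apply cont_comp|].
  assert (HF' : forall j, Ck V k (fun v => proj1_sig (F v) j)).
  { intros j. apply Ck_pred, HF. }
  assert (HFc : forall j, cont_on V (fun v => proj1_sig (F v) j)).
  { intros j. exact (Ck_cont _ _ (HF j)). }
  destruct Hg as [Hg Dg]. split; [now apply cont_comp|].
  destruct (dep_choice_fun _ Dg) as [dg Hdg].
  intros i. destruct (dep_choice_fun _ (fun j => proj2 (HF j) i)) as [dF HdF].
  exists (fun v => rsum (fin_list n) (fun j => dg j (F v) * dF j v)). split.
  - intros v. apply partial_comp; try assumption.
    + intros j. apply Hdg.
    + intros j. exact (Ck_cont _ _ (proj2 (Hdg j))).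
    + intros j. apply HdF.
  - apply (Ck_sum HV). intros j _. apply Ck_mult; [exact HV| |apply HdF].
    apply IH; [apply Hdg|exact HF'].
Qed.

(** The universal properties quantify over diffeologies, so this is what allows real functions on
    pushouts and colimits to be defined by them. *)
Lemma R_diff_IsDiffeology : IsDiffeology R_diff.
Proof.
  split; [|split; [|split]].
  - now intros n U p [H _].
  - intros n U x HU. split; [exact HU|]. intros k. apply Ck_const.
  - intros n m U V p F [HU Hp] HV HF. split; [exact HV|]. intros k.
    apply (Ck_comp HU HV F); [apply Hp|]. intros j. apply HF.
  - intros n U p HU H. split; [exact HU|]. intros k. apply Ck_local; [exact HU|].
    intros x. destruct (H x) as [W [HW [Wo [Wx [_ K]]]]]. exists W, HW. split; [exact Wo|]. split; [exact Wx|apply K].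
Qed.

(** * Real-valued smooth functions on diffeological spaces *)

Definition indiscrete (T : Type) : DiffSp := {| carrier := T; plot := fun n U _ => is_open U |}.

Lemma indiscrete_IsDiffeology T : IsDiffeology (indiscrete T).
Proof. repeat split; simpl; auto. Qed.

(** The fragment of [IsDiffeology] on which the calculus of real functions rests; for subsets of R^n
    it is immediate from the definition of a plot. *)
Definition plots_open (X : DiffSp) : Prop := forall n U p, plot X n U p -> is_open U.

Notation smoothR := (@smooth _ R_diff).

Lemma smooth_compose {A B C : DiffSp} (f : A -> B) (g : B -> C) :
  smooth f -> smooth g -> smooth (fun x => g (f x)).
Proof. intros Hf Hg n U p Hp. exact (Hg n U _ (Hf n U p Hp)). Qed.

Lemma Dopen_preimage {A B : DiffSp} (f : A -> B) (V : B -> Prop) :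
  smooth f -> Dopen B V -> Dopen A (fun x => V (f x)).
Proof. intros Hf HV n U p Hp. exact (HV n U _ (Hf n U p Hp)). Qed.

Lemma Dopen_ext {A : DiffSp} (V W : A -> Prop) : (forall x, V x <-> W x) -> Dopen A V -> Dopen A W.
Proof.
  intros H HV. replace W with V; [exact HV|]. apply functional_extensionality. intros x.
  now apply propositional_extensionality.
Qed.

Section RealFunctions.
Context {X : DiffSp} (HX : plots_open X).

Lemma smoothR_const c : smoothR (fun _ : X => c).
Proof. intros n U p Hp. split; [eapply HX, Hp|]. intros k. apply Ck_const. Qed.

Lemma smoothR_plus (f g : X -> R) : smoothR f -> smoothR g -> smoothR (fun x => f x + g x).
Proof.
  intros Hf Hg n U p Hp. destruct (Hf n U p Hp) as [Uo Kf], (Hg n U p Hp) as [_ Kg].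
  split; [exact Uo|]. intros k. now apply Ck_plus.
Qed.

Lemma smoothR_mult (f g : X -> R) : smoothR f -> smoothR g -> smoothR (fun x => f x * g x).
Proof.
  intros Hf Hg n U p Hp. destruct (Hf n U p Hp) as [Uo Kf], (Hg n U p Hp) as [_ Kg].
  split; [exact Uo|]. intros k. now apply Ck_mult.
Qed.

Lemma smoothR_comp1 (D : R -> Prop) (F : (R -> R) -> Prop) :
  (forall h, F h -> exists h', F h' /\ forall x, D x -> derivable_pt_lim h x (h' x)) ->
  forall (f : X -> R) h, F h -> (forall x, D (f x)) -> smoothR f -> smoothR (fun x => h (f x)).
Proof.
  intros HF f h Hh HD Hf n U p Hp. destruct (Hf n U p Hp) as [Uo Kf].
  split; [exact Uo|]. intros k.
  apply (Ck_comp1 Uo D F HF k (fun u => f (p u)) h Hh); [intros x; apply HD|apply Kf].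
Qed.

Lemma smoothR_opp (f : X -> R) : smoothR f -> smoothR (fun x => - f x).
Proof.
  intros Hf. replace (fun x => - f x) with (fun x => -1 * f x).
  - apply smoothR_mult; [apply smoothR_const|exact Hf].
  - apply functional_extensionality. intros x. ring.
Qed.

Lemma smoothR_minus (f g : X -> R) : smoothR f -> smoothR g -> smoothR (fun x => f x - g x).
Proof. intros Hf Hg. apply smoothR_plus; [exact Hf|now apply smoothR_opp]. Qed.

Lemma smoothR_inv (f : X -> R) : smoothR f -> (forall x, f x <> 0) -> smoothR (fun x => / f x).
Proof.
  intros Hf Hn.
  (* The functions [c * x^(-k)] form a family closed under differentiation away from 0. *)
  apply (smoothR_comp1 (fun x => x <> 0) (fun h => exists c k, h = fun x => c * (/ x) ^ k)) with (h := Rinv);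
    [|exists 1, 1%nat; apply functional_extensionality; intros x; ring|exact Hn|exact Hf].
  intros h [c [k ->]]. exists (fun x => - c * INR k * (/ x) ^ (S k)). split.
  - now exists (- c * INR k), (S k).
  - intros x Hx. apply is_derive_Reals. auto_derive; [exact Hx|].
    destruct k as [|k]; [simpl; ring|]. simpl pred. simpl pow. field. exact Hx.
Qed.

Lemma smoothR_rsum {I} (l : list I) (f : I -> X -> R) :
  (forall i, In i l -> smoothR (f i)) -> smoothR (fun x => rsum l (fun i => f i x)).
Proof.
  unfold rsum. induction l as [|i l IH]; simpl; intros H; [apply smoothR_const|].
  apply (smoothR_plus (f i)); [apply H; now left|]. apply IH. intros j Hj. apply H. now right.
Qed.

Definition rprod {I : Type} (l : list I) (a : I -> R) : R := fold_right Rmult 1 (map a l).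

Lemma smoothR_rprod {I} (l : list I) (f : I -> X -> R) :
  (forall i, In i l -> smoothR (f i)) -> smoothR (fun x => rprod l (fun i => f i x)).
Proof.
  unfold rprod. induction l as [|i l IH]; simpl; intros H; [apply smoothR_const|].
  apply (smoothR_mult (f i)); [apply H; now left|]. apply IH. intros j Hj. apply H. now right.
Qed.

Lemma Dopen_lt (f : X -> R) c : smoothR f -> Dopen X (fun x => f x < c).
Proof.
  intros Hf n U p Hp. destruct (Hf n U p Hp) as [Uo Kf].
  intros x [h Hx]. destruct (Kf O (exist U x h) (c - f (p (exist U x h)))) as [d [Hd K]]; [lra|].
  destruct (Uo x h) as [e [He Ke]].
  exists (Rmin d e). split; [now apply Rmin_pos|]. intros y Hy.
  assert (Uy : U y). { apply Ke. intros i. eapply Rlt_le_trans; [apply Hy|apply Rmin_r]. }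
  exists Uy. assert (Q := K (exist U y Uy)). simpl in Q.
  assert (Rabs (f (p (exist U y Uy)) - f (p (exist U x h))) < c - f (p (exist U x h))).
  { apply Q. intros i. eapply Rlt_le_trans; [apply Hy|apply Rmin_l]. }
  apply Rabs_def2 in H. lra.
Qed.

Lemma Dopen_gt (f : X -> R) c : smoothR f -> Dopen X (fun x => c < f x).
Proof.
  intros Hf. apply (Dopen_ext (fun x => - f x < - c)).
  - intros x. lra.
  - now apply Dopen_lt, smoothR_opp.
Qed.

Lemma Dopen_and (V W : X -> Prop) : Dopen X V -> Dopen X W -> Dopen X (fun x => V x /\ W x).
Proof.
  intros HV HW n U p Hp x [h [Vx Wx]].
  destruct (HV n U p Hp x (ex_intro _ h Vx)) as [d [Hd K]].
  destruct (HW n U p Hp x (ex_intro _ h Wx)) as [e [He K']].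
  exists (Rmin d e). split; [now apply Rmin_pos|]. intros y Hy.
  destruct (K y) as [h1 V1]. { intros i. eapply Rlt_le_trans; [apply Hy|apply Rmin_l]. }
  destruct (K' y) as [h2 W2]. { intros i. eapply Rlt_le_trans; [apply Hy|apply Rmin_r]. }
  exists h1. split; [exact V1|]. now rewrite (proof_irrelevance _ h1 h2).
Qed.

Lemma Dopen_or (V W : X -> Prop) : Dopen X V -> Dopen X W -> Dopen X (fun x => V x \/ W x).
Proof.
  intros HV HW n U p Hp x [h [Vx|Wx]].
  - destruct (HV n U p Hp x (ex_intro _ h Vx)) as [d [Hd K]].
    exists d. split; [exact Hd|]. intros y Hy. destruct (K y Hy) as [h1 V1]. exists h1. now left.
  - destruct (HW n U p Hp x (ex_intro _ h Wx)) as [d [Hd K]].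
    exists d. split; [exact Hd|]. intros y Hy. destruct (K y Hy) as [h1 V1]. exists h1. now right.
Qed.

Lemma Dopen_const (P : Prop) : Dopen X (fun _ => P).
Proof.
  intros n U p Hp x [h HP]. destruct (HX n U p Hp x h) as [e [He K]].
  exists e. split; [exact He|]. intros y Hy. exists (K y Hy). exact HP.
Qed.

Lemma Dopen_forall {I} (l : list I) (V : I -> X -> Prop) :
  (forall i, Dopen X (V i)) -> Dopen X (fun x => forall i, In i l -> V i x).
Proof.
  intros H. induction l as [|i l IH].
  - apply (Dopen_ext (fun _ => True)); [|apply Dopen_const]. intros x. simpl. tauto.
  - apply (Dopen_ext (fun x => V i x /\ forall j, In j l -> V j x)); [|now apply Dopen_and].
    intros x. split.
    + intros [A B] j [<-|Hj]; auto.
    + intros A. split; [|intros j Hj]; apply A; [now left|now right].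
Qed.

End RealFunctions.

(** A plot pulls [V] back to an open [W] and restricts there to a plot landing in [V], where [f] and
    [g] agree. The locality axiom of [R_diff] glues the pieces. *)
Lemma smoothR_local {X : DiffSp} (HX : IsDiffeology X) (f : X -> R) :
  (forall x, exists V g, Dopen X V /\ V x /\ smoothR g /\ forall y, V y -> f y = g y) -> smoothR f.
Proof.
  intros H n U p Hp.
  assert (Uo : is_open U) by exact (proj1 HX n U p Hp).
  apply R_diff_IsDiffeology; [exact Uo|]. intros u.
  destruct (H (p u)) as [V [g [Vo [Vx [Hg E]]]]].
  set (W := fun x => exists h : U x, V (p (exist U x h))).
  assert (HW : forall y, W y -> U y) by (intros y [h _]; exact h).
  exists W, HW. split; [exact (Vo n U p Hp)|]. split.
  { exists (proj2_sig u). now replace (exist U _ _) with u by now apply sig_ext. }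
  assert (Wp : plot X n W (fun w => p (restrict HW w))).
  { apply (proj1 (proj2 (proj2 HX)) n n U W p (restrict HW)); [exact Hp|exact (Vo n U p Hp)|].
    intros j. apply smooth_proj. }
  destruct (Hg n W _ Wp) as [Wo K]. split; [exact Wo|].
  match goal with |- smooth_fun _ ?a => replace a with (fun w => g (p (restrict HW w))) end; [exact K|].
  apply functional_extensionality. intros [w [h Vw]]. symmetry.
  change (f (p (restrict HW (exist W w (ex_intro _ h Vw)))) = g (p (restrict HW (exist W w (ex_intro _ h Vw))))).
  apply E. replace (restrict HW _) with (exist U w h); [exact Vw|now apply sig_ext].
Qed.

(** * Flat functions and cubes *)

(** For [k = 0] this is the classical [exp(-1/t)], extended by 0. The powers of [1/t] are what
    differentiation produces. *)
Definition flat (k : nat) (t : R) : R := if Rlt_dec 0 t then (/ t) ^ k * exp (- / t) else 0.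

Lemma flat_pos k t : 0 < t -> 0 < flat k t.
Proof.
  intros H. unfold flat. destruct Rlt_dec; [|easy].
  apply Rmult_lt_0_compat; [|apply exp_pos]. apply pow_lt. now apply Rinv_0_lt_compat.
Qed.

Lemma flat_0 k t : t <= 0 -> flat k t = 0.
Proof. intros H. unfold flat. destruct Rlt_dec; [lra|easy]. Qed.

Lemma flat_nonneg k t : 0 <= flat k t.
Proof.
  destruct (Rlt_dec 0 t) as [H|H]; [left; now apply flat_pos|]. rewrite flat_0; lra.
Qed.

Lemma exp_mult_INR k x : exp (INR k * x) = exp x ^ k.
Proof.
  induction k as [|k IH]; [simpl; now rewrite Rmult_0_l, exp_0|].
  rewrite S_INR, Rmult_plus_distr_r, exp_plus, IH, Rmult_1_l. simpl. ring.
Qed.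

(* [exp s = exp (s/k)^k >= (s/k)^k] with [s = 1/t] and [k = m+1]. *)
Lemma flat_linear_bound m t : 0 <= t -> flat m t <= t * INR (S m) ^ S m.
Proof.
  intros Ht. destruct (Req_dec t 0) as [->|Hn]; [rewrite flat_0; lra|].
  assert (Hp : 0 < t) by lra. unfold flat. destruct Rlt_dec as [_|]; [|easy].
  set (s := / t). assert (Hs : 0 < s) by now apply Rinv_0_lt_compat.
  set (k := S m). assert (Hk : 0 < INR k) by (apply lt_0_INR; unfold k; lia).
  assert (E : exp s = exp (s / INR k) ^ k).
  { rewrite <- exp_mult_INR. f_equal. field. lra. }
  assert (B : (s / INR k) ^ k <= exp s).
  { rewrite E. apply pow_incr. split; [apply Rlt_le; now apply Rdiv_lt_0_compat|].
    assert (K := exp_ineq1_le (s / INR k)). lra. }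
  unfold Rdiv in B. rewrite Rpow_mult_distr, pow_inv in B.
  assert (Hkk : 0 < INR k ^ k) by now apply pow_lt.
  assert (B' : s ^ k <= exp s * INR k ^ k).
  { apply (Rmult_le_compat_r (INR k ^ k)) in B; [|lra]. rewrite Rmult_assoc, Rinv_l in B; lra. }
  rewrite exp_Ropp.
  assert (Es : s ^ m = t * s ^ k).
  { unfold k. simpl. unfold s. field. lra. }
  rewrite Es, Rmult_assoc. apply Rmult_le_compat_l; [lra|].
  apply (Rmult_le_reg_r (exp s)); [apply exp_pos|].
  rewrite Rmult_assoc, Rinv_l; [lra|]. assert (Z := exp_pos s). lra.
Qed.

(** Away from 0 this is the product rule. At 0 the difference quotient for [h > 0] is
    [flat (S k) h], which the linear bound sends to 0. *)
Lemma flat_derivable k t :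
  derivable_pt_lim (flat k) t (- INR k * flat (S k) t + flat (S (S k)) t).
Proof.
  destruct (Rtotal_order t 0) as [H|[->|H]].
  - rewrite !flat_0 by lra. rewrite Rmult_0_r, Rplus_0_l.
    intros eps He. assert (Hd : 0 < - t) by lra. exists (mkposreal _ Hd). simpl. intros h Hh Hhd.
    apply Rabs_def2 in Hhd. rewrite !flat_0 by lra.
    replace ((0 - 0) / h - 0) with 0 by (field; exact Hh). now rewrite Rabs_R0.
  - rewrite !flat_0 by lra. rewrite Rmult_0_r, Rplus_0_l.
    intros eps He. set (C := INR (S (S k)) ^ S (S k)).
    assert (HC : 0 < C) by (apply pow_lt, lt_0_INR; lia).
    exists (mkposreal _ (Rdiv_lt_0_compat _ _ He HC)). simpl. intros h Hh Hhd.
    rewrite Rplus_0_l, (flat_0 k 0), !Rminus_0_r by lra.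
    destruct (Rlt_dec 0 h) as [Hp|Hp].
    + replace (flat k h / h) with (flat (S k) h).
      * rewrite Rabs_pos_eq by apply flat_nonneg. rewrite Rabs_pos_eq in Hhd by lra.
        eapply Rle_lt_trans; [apply flat_linear_bound; lra|]. fold C.
        apply (Rmult_lt_compat_r C) in Hhd; [|exact HC].
        replace (eps / C * C) with eps in Hhd by (field; lra). exact Hhd.
      * unfold flat. destruct Rlt_dec; [|easy]. simpl. field. exact Hh.
    + rewrite flat_0 by lra. unfold Rdiv. now rewrite Rmult_0_l, Rabs_R0.
  - apply is_derive_Reals.
    apply is_derive_ext_loc with (fun t => (/ t) ^ k * exp (- / t)).
    + exists (mkposreal t H). intros y Hy. unfold ball in Hy; simpl in Hy.
      unfold AbsRing_ball, minus, plus, opp, abs in Hy; simpl in Hy.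
      apply Rabs_def2 in Hy. unfold flat. destruct Rlt_dec; [easy|lra].
    + unfold flat. destruct Rlt_dec as [_|]; [|easy]. auto_derive; [lra|].
      destruct k as [|k]; [simpl; field; lra|]. simpl pred. simpl pow. field. lra.
Qed.

(** Differentiating [flat k] gives a combination of two others, so the linear span is the family
    closed under differentiation that [Ck_comp1] requires. *)
Inductive flat_span : (R -> R) -> Prop :=
| flat_span_base k : flat_span (flat k)
| flat_span_comb a f b g : flat_span f -> flat_span g -> flat_span (fun t => a * f t + b * g t).

Lemma flat_span_derivable f : flat_span f ->
  exists f', flat_span f' /\ forall t, True -> derivable_pt_lim f t (f' t).
Proof.
  induction 1 as [k|a f b g Hf [f' [Sf Df]] Hg [g' [Sg Dg]]].
  - exists (fun t => - INR k * flat (S k) t + 1 * flat (S (S k)) t). split.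
    + apply flat_span_comb; apply flat_span_base.
    + intros t _. rewrite Rmult_1_l. apply flat_derivable.
  - exists (fun t => a * f' t + b * g' t). split; [now apply flat_span_comb|].
    intros t _. apply derivable_pt_lim_plus; apply derivable_pt_lim_scal; auto.
Qed.

Lemma smoothR_flat {X : DiffSp} (HX : plots_open X) k (f : X -> R) :
  smoothR f -> smoothR (fun x => flat k (f x)).
Proof.
  apply (smoothR_comp1 (fun _ => True) flat_span flat_span_derivable); [apply flat_span_base|easy].
Qed.

(** * Cubes: faces, extension from the boundary, and a bump in the interior *)

Lemma sub_Rn_plots_open n A : plots_open (sub_Rn n A).
Proof. now intros m U p [H _]. Qed.

Lemma smoothR_coord n A (i : Fin.t n) : smoothR (fun y : sub_Rn n A => proj1_sig y i).
Proof. intros m U p [HU Hp]. split; [exact HU|]. apply Hp. Qed.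

Lemma cube_face {n} (i : Fin.t n) (b : bool) (x : Rn n) : cube n x ->
  cube_boundary n (fun j => if Fin.eq_dec i j then (if b then 1 else 0) else x j).
Proof.
  intros H. split.
  - intros j. destruct Fin.eq_dec; [destruct b; lra|]. apply H.
  - exists i. destruct Fin.eq_dec; [|easy]. destruct b; [now right|now left].
Qed.

(** Projection of the cube onto a closed face. Composing with it turns a function known only on the
    boundary into one on the whole cube, smoothly. *)
Definition set_face {n} (i : Fin.t n) (b : bool) (x : In_cube n) : dIn_cube n :=
  exist (cube_boundary n) _ (cube_face i b (proj1_sig x) (proj2_sig x)).

Lemma set_face_smooth {n} (i : Fin.t n) b : smooth (set_face i b).
Proof.
  intros m U p [HU Hp]. split; [exact HU|]. intros j k. simpl.
  destruct (Fin.eq_dec i j); [apply Ck_const|apply Hp].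
Qed.

Lemma set_face_id {n} (i : Fin.t n) (b : bool) (y : dIn_cube n) :
  proj1_sig y i = (if b then 1 else 0) -> set_face i b (bdry_incl n y) = y.
Proof.
  intros H. apply sig_ext. apply functional_extensionality. intros j. simpl.
  destruct Fin.eq_dec as [<-|]; easy.
Qed.

Lemma bdry_incl_smooth n : smooth (bdry_incl n).
Proof. intros m U p [HU Hp]. split; [exact HU|]. exact Hp. Qed.

(* Transfinite interpolation: the error on the faces already treated vanishes, and
   so does its linear interpolation in a further coordinate. *)
Lemma boundary_extension n (g : dIn_cube n -> R) : smoothR g ->
  exists F : In_cube n -> R, smoothR F /\ forall y, F (bdry_incl n y) = g y.
Proof.
  intros Hg.
  assert (G : forall l : list (Fin.t n), exists F : In_cube n -> R, smoothR F /\
     forall y : dIn_cube n, (exists i, In i l /\ (proj1_sig y i = 0 \/ proj1_sig y i = 1)) ->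
       F (bdry_incl n y) = g y).
  { induction l as [|i l [F [HF E]]].
    - exists (fun _ => 0). split; [apply smoothR_const, sub_Rn_plots_open|].
      now intros y [i [[] _]].
    - set (r := fun y => g y - F (bdry_incl n y)).
      assert (Hr : smoothR r).
      { apply (smoothR_minus (sub_Rn_plots_open _ _)); [exact Hg|].
        exact (smooth_compose (C := R_diff) _ _ (bdry_incl_smooth n) HF). }
      assert (Hrb : forall b, smoothR (fun x => r (set_face i b x))).
      { intros b. exact (smooth_compose (C := R_diff) _ _ (set_face_smooth i b) Hr). }
      exists (fun x : In_cube n => F x + ((1 - proj1_sig x i) * r (set_face i false x)
         + proj1_sig x i * r (set_face i true x))).
      split.
      + apply smoothR_plus; [exact HF|].
        apply smoothR_plus; apply smoothR_mult; try apply Hrb; try apply smoothR_coord.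
        apply (smoothR_minus (sub_Rn_plots_open _ _)); [|apply smoothR_coord].
        apply smoothR_const, sub_Rn_plots_open.
      + intros y [j [Hj Hy]].
        change (proj1_sig (bdry_incl n y) i) with (proj1_sig y i).
        destruct (Req_dec (proj1_sig y i) 0) as [H0|H0].
        { rewrite (set_face_id i false) by exact H0. rewrite H0. unfold r. ring. }
        destruct (Req_dec (proj1_sig y i) 1) as [H1|H1].
        { rewrite (set_face_id i true) by exact H1. rewrite H1. unfold r. ring. }
        assert (Nij : i <> j) by (intros ->; tauto).
        destruct Hj as [Hj|Hj]; [easy|].
        (* Changing coordinate [i] keeps coordinate [j], so the projected point still lies on a face
           already treated. *)
        assert (R0 : forall b, r (set_face i b (bdry_incl n y)) = 0).
        { intros b. unfold r. rewrite E; [ring|]. exists j. split; [exact Hj|]. simpl.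
          destruct Fin.eq_dec; easy. }
        rewrite !R0, E; [ring|]. now exists j. }
  destruct (G (fin_list n)) as [F [HF E]]. exists F. split; [exact HF|].
  intros y. apply E. destruct (proj2_sig y) as [_ [i Hi]]. exists i. split; [apply in_fin_list|exact Hi].
Qed.

(** For [n = 0] the empty product is 1, in accordance with the empty boundary of the point. *)
Definition bump {n} (y : In_cube n) : R :=
  rprod (fin_list n) (fun i => proj1_sig y i * (1 - proj1_sig y i)).

Lemma bump_smooth n : smoothR (@bump n).
Proof.
  apply (smoothR_rprod (sub_Rn_plots_open _ _)). intros i _. apply smoothR_mult; [apply smoothR_coord|].
  apply (smoothR_minus (sub_Rn_plots_open _ _)); [|apply smoothR_coord].
  apply smoothR_const, sub_Rn_plots_open.
Qed.

Lemma rprod_pos {I} (l : list I) a : (forall i, In i l -> 0 < a i) -> 0 < rprod l a.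
Proof.
  unfold rprod. induction l as [|i l IH]; simpl; intros H; [lra|].
  apply Rmult_lt_0_compat; [apply H; now left|]. apply IH. intros j Hj. apply H. now right.
Qed.

Lemma rprod_nonneg {I} (l : list I) a : (forall i, In i l -> 0 <= a i) -> 0 <= rprod l a.
Proof.
  unfold rprod. induction l as [|i l IH]; simpl; intros H; [lra|].
  apply Rmult_le_pos; [apply H; now left|]. apply IH. intros j Hj. apply H. now right.
Qed.

Lemma rprod_zero {I} (l : list I) a i : In i l -> a i = 0 -> rprod l a = 0.
Proof.
  unfold rprod. induction l as [|k l IH]; simpl; [easy|]. intros [->|Hi] H.
  - rewrite H. ring.
  - rewrite IH by easy. ring.
Qed.

Lemma bump_interior {n} (y : In_cube n) : ~ cube_boundary n (proj1_sig y) -> 0 < bump y.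
Proof.
  intros H. apply rprod_pos. intros i _.
  assert (C := proj2_sig y i). simpl in C.
  assert (proj1_sig y i <> 0). { intros E. apply H. split; [exact (proj2_sig y)|]. exists i. now left. }
  assert (proj1_sig y i <> 1). { intros E. apply H. split; [exact (proj2_sig y)|]. exists i. now right. }
  apply Rmult_lt_0_compat; lra.
Qed.

Lemma bump_boundary {n} (y : dIn_cube n) : bump (bdry_incl n y) = 0.
Proof.
  destruct (proj2_sig y) as [_ [i Hi]].
  apply rprod_zero with i; [apply in_fin_list|]. simpl. destruct Hi as [-> | ->]; ring.
Qed.

Lemma bump_nonneg {n} (y : In_cube n) : 0 <= bump y.
Proof.
  apply rprod_nonneg. intros i _. assert (C := proj2_sig y i). simpl in C. apply Rmult_le_pos; lra.
Qed.

(** * Compactness of the cube *)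

Definition full (n : nat) : Rn n -> Prop := fun _ => True.

Lemma full_open n : is_open (full n).
Proof. intros x _. exists 1. split; [lra|]. intros y _. exact I. Qed.

Lemma fold_in_cube {n} (t : Rn n) : cube n (fun i => (1 + sin (t i)) / 2).
Proof. intros i. assert (B := SIN_bound (t i)). lra. Qed.

(* Being surjective and defined on all of R^n, it pulls [D]-open covers of the cube back to
   open covers of R^n; compactness then needs no description of the [D]-topology of the cube. *)
Definition fold_plot {n} (t : sig (full n)) : In_cube n :=
  exist (cube n) _ (fold_in_cube (proj1_sig t)).

Lemma fold_plot_plot n : plot (In_cube n) n (full n) fold_plot.
Proof.
  split; [apply full_open|]. intros i k. simpl.
  apply (Ck_comp1 (full_open n) (fun _ => True)
    (fun h => exists a c d, h = fun x => a + c * sin x + d * cos x)) with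
    (h := fun x => (1 + sin x) / 2).
  - intros h [a [c [d ->]]]. exists (fun x => 0 + (- d) * sin x + c * cos x). split.
    + now exists 0, (- d), c.
    + intros x _. apply is_derive_Reals. auto_derive; [easy|ring].
  - exists (1 / 2), (1 / 2), 0. apply functional_extensionality. intros x. field.
  - easy.
  - apply smooth_proj.
Qed.

(** [Tn] is the nested-pair form of R^n in which [compactness_list] is stated. *)
Fixpoint to_tuple (n : nat) : Rn n -> Compactness.Tn n R :=
  match n with
  | O => fun _ => tt
  | S m => fun x => (x Fin.F1, to_tuple m (fun i => x (Fin.FS i)))
  end.

Fixpoint of_tuple (n : nat) : Compactness.Tn n R -> Rn n :=
  match n with
  | O => fun _ i => 0
  | S m => fun t i => Fin.caseS' i (fun _ => R) (fst t) (fun j => of_tuple m (snd t) j)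
  end.

Lemma of_to_tuple n (x : Rn n) i : of_tuple n (to_tuple n x) i = x i.
Proof.
  induction n as [|n IH]; [apply Fin.case0; exact i|].
  pattern i. apply Fin.caseS'; simpl; [easy|]. intros j. apply (IH (fun i => x (Fin.FS i))).
Qed.

Lemma close_of_tuple n d (x t : Compactness.Tn n R) :
  close_n n d x t -> forall i, Rabs (of_tuple n x i - of_tuple n t i) < d.
Proof.
  induction n as [|n IH]; intros H i; [apply (Fin.case0 (fun _ => _)); exact i|].
  destruct x as [x1 x2], t as [t1 t2]. destruct H as [H1 H2].
  pattern i. apply Fin.caseS'; simpl; [exact H1|]. intros j. now apply IH.
Qed.

Lemma bounded_to_tuple n (a b x : Rn n) : (forall i, a i <= x i <= b i) ->
  bounded_n n (to_tuple n a) (to_tuple n b) (to_tuple n x).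
Proof.
  induction n as [|n IH]; intros H; [exact I|]. split; [apply H|].
  apply (IH (fun i => a (Fin.FS i)) (fun i => b (Fin.FS i)) (fun i => x (Fin.FS i))). intros i. apply H.
Qed.

Lemma cube_compact n {I : Type} (V : I -> In_cube n -> Prop) :
  (forall i, Dopen (In_cube n) (V i)) -> (forall c, exists i, V i c) ->
  exists l : list I, forall c, exists i, In i l /\ V i c.
Proof.
  intros Vo Vc.
  set (q := fun t : Rn n => fold_plot (exist (full n) t Logic.I)).
  assert (H : forall t : Rn n, exists p : I * posreal,
    forall y, (forall j, Rabs (y j - t j) < snd p) -> V (fst p) (q y)).
  { intros t. destruct (Vc (q t)) as [i Hi].
    destruct (Vo i n (full n) _ (fold_plot_plot n) t (ex_intro _ Logic.I Hi)) as [e [He K]].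
    exists (i, mkposreal e He). simpl. intros y Hy. destruct (K y Hy) as [[] h]. exact h. }
  destruct (dep_choice_fun _ H) as [s Hs].
  (* The compactness theorem is doubly negated, hence [NNPP]. The box [[-2,2]^n] contains
     [[-pi/2,pi/2]^n], which the folding map already sends onto the cube. *)
  destruct (NNPP _ (compactness_list n (to_tuple n (fun _ => -2)) (to_tuple n (fun _ => 2))
    (fun t => snd (s (of_tuple n t))))) as [l Hl].
  exists (map (fun t => fst (s (of_tuple n t))) l). intros c.
  set (x := fun i => asin (2 * proj1_sig c i - 1)).
  assert (C : forall i, 0 <= proj1_sig c i <= 1) by exact (proj2_sig c).
  destruct (Hl (to_tuple n x)) as [t [Ht [_ Hc]]].
  { apply bounded_to_tuple. intros i. assert (B := asin_bound (2 * proj1_sig c i - 1)).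
    assert (B' := PI_4). unfold x. lra. }
  exists (fst (s (of_tuple n t))). split; [now apply (in_map (fun t => fst (s (of_tuple n t))))|].
  replace c with (q x).
  - apply Hs. intros j. rewrite <- (of_to_tuple n x). now apply close_of_tuple.
  - apply sig_ext. apply functional_extensionality. intros i. simpl. unfold x.
    specialize (C i). rewrite sin_asin; lra.
Qed.

(** * Smooth regularity of cell complexes *)

(* Above level 1/2 but outside [W] the extension lives on a compact subset of the
   interior, where subtracting a large multiple of [bump] pushes it below 1/2. *)
Lemma cube_extension_within {n} (W : In_cube n -> Prop) (r : dIn_cube n -> R) :
  Dopen (In_cube n) W -> smoothR r -> (forall y, 1 / 2 <= r y -> W (bdry_incl n y)) ->
  exists F : In_cube n -> R, smoothR F /\ (forall y, F (bdry_incl n y) = r y) /\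
    forall c, 1 / 2 <= F c -> W c.
Proof.
  intros HW Hr Hin. destruct (boundary_extension n r Hr) as [F [HF E]].
  assert (P := sub_Rn_plots_open n (cube n)).
  assert (Hsm : forall M, smoothR (fun c : In_cube n => F c - M * bump c)).
  { intros M. apply (smoothR_minus P); [exact HF|].
    apply smoothR_mult; [apply (smoothR_const P)|apply bump_smooth]. }
  (* The cover is indexed by the multiple of [bump] that suffices at a point; compactness leaves
     finitely many multiples. *)
  destruct (cube_compact n (fun (M : R) c => 0 <= M /\ (W c \/ F c - M * bump c < 1 / 2))) as [l Hl].
  - intros M. apply Dopen_and; [apply Dopen_const, P|]. apply Dopen_or; [exact HW|].
    now apply Dopen_lt.
  - intros c. destruct (classic (cube_boundary n (proj1_sig c))) as [B|B].
    + exists 0. split; [lra|]. destruct (Rle_dec (1 / 2) (F c)) as [L|L]; [left|right; lra].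
      replace c with (bdry_incl n (exist _ _ B)) in * by now apply sig_ext.
      apply Hin. now rewrite <- E.
    (* This multiple brings the value at [c] down to 0 or below. *)
    + assert (Hb := bump_interior c B). exists (Rmax 0 (F c / bump c)).
      split; [apply Rmax_l|]. right.
      assert (K := Rmax_r 0 (F c / bump c)). apply (Rmult_le_compat_r (bump c)) in K; [|lra].
      unfold Rdiv in K at 1. rewrite Rmult_assoc, Rinv_l in K; lra.
  (* The sum of the positive parts dominates every multiple in the list, and since [bump >= 0] a
     larger multiple only lowers the function. *)
  - set (M := rsum l (fun m => Rmax 0 m)). exists (fun c => F c - M * bump c).
    split; [apply Hsm|]. split.
    + intros y. rewrite bump_boundary, E. ring.
    + intros c Hc. destruct (Hl c) as [m [Hm [Hm0 [H|H]]]]; [exact H|].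
      assert (Hb := bump_nonneg c).
      assert (K : Rmax 0 m <= M).
      { apply (rsum_term_le l (fun m => Rmax 0 m)); [|exact Hm]. intros i _. apply Rmax_l. }
      assert (K' := Rmax_r 0 m). nra.
Qed.

Lemma open_cube_open n : is_open (fun x : Rn n => forall i, 0 < x i < 1).
Proof.
  intros x Hx.
  destruct (fin_uniform_radius (fun i d => d <= x i /\ d <= 1 - x i)) as [d [Hd K]].
  - intros j a b Hab H. lra.
  - intros j. exists (Rmin (x j) (1 - x j)). specialize (Hx j). split; [apply Rmin_pos; lra|].
    split; [apply Rmin_l|apply Rmin_r].
  - exists d. split; [exact Hd|]. intros y Hy i. specialize (K i). specialize (Hy i).
    apply Rabs_def2 in Hy. lra.
Qed.

Lemma open_cube_in_cube n (x : Rn n) : (forall i, 0 < x i < 1) -> cube n x.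
Proof. intros H i. specialize (H i). lra. Qed.

(** The inclusion of the open cube is a plot, so along it [W] becomes an ordinary open set around
    [c]. Points of the resulting ball lie in the open cube by construction. *)
Lemma cube_interior_ball {n} (W : In_cube n -> Prop) (c : In_cube n) :
  Dopen (In_cube n) W -> W c -> ~ cube_boundary n (proj1_sig c) ->
  exists eps, 0 < eps /\ forall y : In_cube n,
    (forall i, Rabs (proj1_sig y i - proj1_sig c i) < eps) -> W y.
Proof.
  intros HW Wc Hc.
  set (p := fun u : sig (fun x : Rn n => forall i, 0 < x i < 1) =>
    exist (cube n) (proj1_sig u) (open_cube_in_cube n _ (proj2_sig u)) : In_cube n).
  assert (Hp : plot (In_cube n) n _ p).
  { split; [apply open_cube_open|]. intros j. apply smooth_proj. }
  assert (Ic : forall i, 0 < proj1_sig c i < 1).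
  { intros i. assert (C := proj2_sig c i). simpl in C.
    assert (proj1_sig c i <> 0). { intros E. apply Hc. split; [exact (proj2_sig c)|]. exists i. now left. }
    assert (proj1_sig c i <> 1). { intros E. apply Hc. split; [exact (proj2_sig c)|]. exists i. now right. }
    lra. }
  destruct (HW n _ p Hp (proj1_sig c)) as [e [He K]].
  - exists Ic. replace (p (exist _ _ Ic)) with c; [exact Wc|now apply sig_ext].
  - exists e. split; [exact He|]. intros y Hy. destruct (K _ Hy) as [h Hh].
    replace y with (p (exist _ _ h)); [exact Hh|now apply sig_ext].
Qed.

(** A multiple of [bump y * (1 - |y - c|^2 / e^2)] is added, with Euclidean norm. Outside the ball
    of radius [e] it is at most 0, so no new point reaches 1/2; inside, membership in [W] is known.
    The factor [bump] preserves the boundary values. *)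
Lemma cube_raise_at_interior {n} (W : In_cube n -> Prop) (F : In_cube n -> R) (c : In_cube n) :
  Dopen (In_cube n) W -> W c -> ~ cube_boundary n (proj1_sig c) ->
  smoothR F -> (forall y, 1 / 2 <= F y -> W y) ->
  exists F' : In_cube n -> R, smoothR F' /\ (forall y, F' (bdry_incl n y) = F (bdry_incl n y)) /\
    (forall y, 1 / 2 <= F' y -> W y) /\ 1 <= F' c.
Proof.
  intros HW Wc Hc HF Hin.
  destruct (cube_interior_ball W c HW Wc Hc) as [e [He K]].
  assert (P := sub_Rn_plots_open n (cube n)).
  set (d := fun y : In_cube n => rsum (fin_list n) (fun i =>
     (proj1_sig y i - proj1_sig c i) * (proj1_sig y i - proj1_sig c i))).
  assert (Hb := bump_interior c Hc).
  (* At [c] the added term is [k * bump c], which makes up the deficit [1 - F c]; [Rmax] keeps the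
     multiple nonnegative. *)
  set (k := Rmax 0 ((1 - F c) / bump c)).
  assert (Hk : 0 <= k) by apply Rmax_l.
  exists (fun y => F y + k * (bump y * (1 - / (e * e) * d y))). split; [|split; [|split]].
  - apply smoothR_plus; [exact HF|]. apply smoothR_mult; [apply (smoothR_const P)|].
    apply smoothR_mult; [apply bump_smooth|]. apply (smoothR_minus P); [apply (smoothR_const P)|].
    apply smoothR_mult; [apply (smoothR_const P)|]. apply (smoothR_rsum P). intros i _.
    apply smoothR_mult; apply (smoothR_minus P); try apply smoothR_coord; apply (smoothR_const P).
  - intros y. rewrite bump_boundary. ring.
  - intros y Hy. destruct (Rlt_dec (d y) (e * e)) as [L|L].
    + apply K. intros i.
      assert (T : (proj1_sig y i - proj1_sig c i) * (proj1_sig y i - proj1_sig c i) <= d y).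
      { apply (rsum_term_le (fin_list n) (fun i =>
         (proj1_sig y i - proj1_sig c i) * (proj1_sig y i - proj1_sig c i))); [|apply in_fin_list].
        intros j _. apply Rle_0_sqr. }
      apply Rabs_def1; nra.
    + apply Hin. assert (Q : 1 <= / (e * e) * d y).
      { apply Rmult_le_reg_l with (e * e); [nra|]. rewrite <- Rmult_assoc, Rinv_r; nra. }
      assert (B := bump_nonneg y).
      assert (0 <= k * bump y) by now apply Rmult_le_pos. nra.
  - assert (D0 : d c = 0).
    { unfold d, rsum. clear. induction (fin_list n) as [|i l IH]; simpl; [easy|]. rewrite IH. ring. }
    rewrite D0, Rmult_0_r, Rminus_0_r, Rmult_1_r.
    assert (Kr := Rmax_r 0 ((1 - F c) / bump c)). fold k in Kr.
    apply (Rmult_le_compat_r (bump c)) in Kr; [|lra].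
    unfold Rdiv in Kr. rewrite Rmult_assoc, Rinv_l in Kr; lra.
Qed.

(** * Locating points in cells *)

Lemma smooth_to_indiscrete {X : DiffSp} {T} (HX : plots_open X) (f : X -> T) :
  @smooth X (indiscrete T) f.
Proof. intros n U p Hp. exact (HX n U p Hp). Qed.

(* Maps into an indiscrete space are unconstrained, so uniqueness of induced maps forces joint surjectivity. *)
Lemma pushout_surjective {n} {A B : DiffSp} (HA : plots_open A) (HB : plots_open B)
  (phi : dIn_cube n -> A) (f : A -> B) (Phi : In_cube n -> B) :
  is_pushout n phi f Phi -> forall b, (exists a, f a = b) \/ (exists c, Phi c = b).
Proof.
  intros [_ [_ [_ H]]] b.
  destruct (H (indiscrete Prop) (fun _ => True) (fun _ => True) (indiscrete_IsDiffeology _))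
    as [u [_ [_ [_ Hu]]]].
  - exact (smooth_to_indiscrete HA _).
  - exact (smooth_to_indiscrete (sub_Rn_plots_open _ _) _).
  - reflexivity.
  - assert (E1 := Hu (fun _ => True) (smooth_to_indiscrete HB _) (fun _ => eq_refl) (fun _ => eq_refl) b).
    assert (E2 : ((exists a, f a = b) \/ (exists c, Phi c = b)) = u b).
    { apply (Hu (fun b => (exists a, f a = b) \/ (exists c, Phi c = b)) (smooth_to_indiscrete HB _)).
      - intros a. apply propositional_extensionality. split; [easy|]. intros _. left. now exists a.
      - intros c. apply propositional_extensionality. split; [easy|]. intros _. right. now exists c. }
    rewrite E2, <- E1. exact I.
Qed.

Lemma colimit_surjective {O : Type} (lt : O -> O -> Prop) (Z : O -> DiffSp)
  (z : forall a b, le lt a b -> Z a -> Z b) (HZ : forall a, plots_open (Z a)) (P : O -> Prop)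
  (Y : DiffSp) (g : forall a, P a -> Z a -> Y) :
  is_colimit_below lt Z z P Y g -> forall y, exists a (ha : P a) x, g a ha x = y.
Proof.
  intros [HY [_ [_ H]]] y. assert (HY' : plots_open Y) by exact (proj1 HY).
  destruct (H (indiscrete Prop) (fun _ _ _ => True) (indiscrete_IsDiffeology _))
    as [u [_ [_ Hu]]].
  - intros a ha. exact (smooth_to_indiscrete (HZ a) _).
  - reflexivity.
  - assert (E1 := Hu (fun _ => True) (smooth_to_indiscrete HY' _) (fun _ _ _ => eq_refl) y).
    assert (E2 : (exists a (ha : P a) x, g a ha x = y) = u y).
    { apply (Hu (fun y => exists a (ha : P a) x, g a ha x = y) (smooth_to_indiscrete HY' _)).
      intros a ha x. apply propositional_extensionality. split; [easy|]. intros _. now exists a, ha, x. }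
    rewrite E2, <- E1. exact I.
Qed.

Lemma wf_minimal {O : Type} (lt : O -> O -> Prop) (Hwf : well_founded lt) (P : O -> Prop) :
  (exists a, P a) -> exists a, P a /\ forall b, lt b a -> ~ P b.
Proof.
  intros [a Pa]. revert Pa. induction (Hwf a) as [a _ IH]. intros Pa.
  destruct (classic (exists b, lt b a /\ P b)) as [[b [Hb Pb]]|N]; [now apply (IH b)|].
  exists a. split; [exact Pa|]. intros b Hb Pb. apply N. now exists b.
Qed.

Section CellComplex.
Context {O : Type} {lt : O -> O -> Prop} (Hord : is_ordinal lt)
  {Z : O -> DiffSp} {z : forall a b, le lt a b -> Z a -> Z b}
  {X : DiffSp} {iota : forall a, Z a -> X}
  (HX : smooth_cell_complex lt Z z X iota).

Lemma stage_IsDiffeology a : IsDiffeology (Z a).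
Proof. exact (proj1 (proj1 (proj1 HX)) a). Qed.

Lemma stage_plots_open a : plots_open (Z a).
Proof. exact (proj1 (stage_IsDiffeology a)). Qed.

Lemma stage_map_id a (h : le lt a a) x : z a a h x = x.
Proof. exact (proj1 (proj2 (proj2 (proj1 (proj1 HX)))) a h x). Qed.

Lemma stage_map_comp a b c (h1 : le lt a b) (h2 : le lt b c) (h3 : le lt a c) x :
  z a c h3 x = z b c h2 (z a b h1 x).
Proof. exact (proj2 (proj2 (proj2 (proj1 (proj1 HX)))) a b c h1 h2 h3 x). Qed.

Lemma iota_smooth a : smooth (iota a).
Proof. destruct HX as [_ [_ [[_ [H _]] _]]]. exact (H a I). Qed.

Lemma iota_stage a b (h : le lt a b) x : iota b (z a b h x) = iota a x.
Proof. destruct HX as [_ [_ [[_ [_ [H _]]] _]]]. exact (H a b I I h x). Qed.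

Lemma iota_surjective x : exists a y, iota a y = x.
Proof.
  destruct HX as [_ [_ [H _]]].
  destruct (colimit_surjective lt Z z stage_plots_open _ _ _ H x) as [a [_ [y E]]].
  now exists a, y.
Qed.

(** At a limit stage every point comes from an earlier stage, and the least stage is empty, so a
    point first appears at a successor. *)
Lemma first_stage_succ a y x : iota a y = x -> (forall b, lt b a -> forall y, iota b y <> x) ->
  exists g, succ_of lt g a.
Proof.
  intros Hy Hmin. apply NNPP. intros N.
  destruct (classic (exists b, lt b a)) as [[b Hb]|E].
  - destruct HX as [[_ Hlim] _].
    destruct (colimit_surjective lt Z z stage_plots_open _ _ _ (Hlim a (conj (ex_intro _ b Hb) N)) y)
      as [c [hc [w Ew]]].
    apply (Hmin c hc w). rewrite <- Hy, <- Ew. symmetry. apply iota_stage.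
  - apply (proj1 (proj2 HX) a); [|exact y]. intros b Hb. apply E. now exists b.
Qed.

(** A point new at stage [s] comes from the cube, and a boundary point of the cube would be sent by
    the attaching map into stage [b]. *)
Lemma cell_interior_lift s b (hs : succ_of lt b s) n phi Phi y x :
  is_pushout n phi (z b s (or_introl (proj1 hs))) Phi ->
  iota s y = x -> (forall w, iota b w <> x) ->
  exists c, Phi c = y /\ ~ cube_boundary n (proj1_sig c).
Proof.
  intros Hp Hy Hmin.
  destruct (pushout_surjective (stage_plots_open b) (stage_plots_open s) _ _ _ Hp y) as [[a E]|[c E]].
  - exfalso. apply (Hmin a). rewrite <- Hy, <- E. symmetry. apply iota_stage.
  - exists c. split; [exact E|]. intros B.
    destruct Hp as [_ [_ [C _]]]. specialize (C (exist _ _ B)).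
    replace (bdry_incl n (exist _ _ B)) with c in C by now apply sig_ext.
    apply (Hmin (phi (exist _ _ B))). rewrite <- Hy, <- E, <- C. symmetry. apply iota_stage.
Qed.

Section Regular.
Context (V : X -> Prop) (HV : Dopen X V) (x : X) (Vx : V x)
  (a0 : O) (x0 : Z a0) (Hx0 : iota a0 x0 = x) (Hmin : forall b, lt b a0 -> forall y, iota b y <> x).

(** The invariant of the recursion, which runs from the least stage. Before [a0] the last clause is
    vacuous; the value at [x] is imposed when stage [a0] is built and inherited afterwards. *)
Definition stage_good (b : O) (f : Z b -> R) : Prop :=
  smoothR f /\ (forall y, 1 / 2 <= f y -> V (iota b y)) /\
  forall h : le lt a0 b, 1 <= f (z a0 b h x0).

(** A good extension exists only if [prev] is good and compatible, which the recursion does not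
    record. [epsilon] makes the step total, and [stage_fun_spec] justifies the choice afterwards. *)
Definition stage_step (b : O) (prev : forall a, lt a b -> Z a -> R) : Z b -> R :=
  epsilon (inhabits (fun _ => 0)) (fun f => stage_good b f /\
    forall a (ha : lt a b) y, f (z a b (or_introl ha) y) = prev a ha y).

Definition stage_fun : forall b, Z b -> R := Fix (proj1 Hord) (fun b => Z b -> R) stage_step.

Lemma stage_fun_eq b : stage_fun b = stage_step b (fun a _ => stage_fun a).
Proof.
  unfold stage_fun at 1. rewrite Fix_eq; [easy|].
  intros c f g H. f_equal. apply functional_extensionality_dep. intros a.
  apply functional_extensionality. intros ha. apply H.
Qed.

Lemma lt_succ_le a b s : succ_of lt b s -> lt a s -> le lt a b.
Proof.
  destruct Hord as [_ [Hirr [Htr Htri]]]. intros [H1 H2] Ha.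
  destruct (Htri a b) as [H|[H|H]]; [now left|now right|].
  exfalso. destruct (H2 a H) as [K| ->]; [exact (Hirr a (Htr _ _ _ Ha K))|exact (Hirr _ Ha)].
Qed.

(** The containment in [V] is pulled back to the cube, the boundary values of [f] are extended
    there, and the pushout glues the result to [f]. Joint surjectivity lets the containment be
    checked on the two pieces. *)
Lemma succ_step b s (hs : succ_of lt b s) (f : Z b -> R) : stage_good b f ->
  exists f' : Z s -> R, stage_good s f' /\ forall y, f' (z b s (or_introl (proj1 hs)) y) = f y.
Proof.
  intros [Sf [Gf Af]].
  destruct (proj2 (proj2 (proj2 HX)) b s hs) as [n [phi [Phi [Hphi Hp]]]].
  set (W := fun c => V (iota s (Phi c))).
  assert (HW : Dopen (In_cube n) W).
  { apply (Dopen_preimage (fun c => iota s (Phi c))); [|exact HV].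
    apply (smooth_compose Phi (iota s)); [apply Hp|apply iota_smooth]. }
  destruct (cube_extension_within W (fun y => f (phi y)) HW) as [F [SF [EF GF]]].
  { exact (smooth_compose (C := R_diff) phi f Hphi Sf). }
  { intros y Hy. unfold W. rewrite <- (proj1 (proj2 (proj2 Hp))), iota_stage. now apply Gf. }
  assert (G : exists F' : In_cube n -> R, smoothR F' /\
     (forall y, F' (bdry_incl n y) = f (phi y)) /\ (forall c, 1 / 2 <= F' c -> W c) /\
     forall e : a0 = s, exists c, Phi c = z a0 s (or_intror e) x0 /\ 1 <= F' c).
  (* Only at [s = a0] must the value at [x] be raised; there [x] is new, so it lifts to an interior
     point of the cube. *)
  { destruct (classic (a0 = s)) as [E|E].
    - assert (Y : iota s (z a0 s (or_intror E) x0) = x) by now rewrite iota_stage.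
      destruct (cell_interior_lift s b hs n phi Phi _ x Hp Y) as [c [Ec Hc]].
      { apply Hmin. rewrite E. apply hs. }
      destruct (cube_raise_at_interior W F c HW) as [F' [SF' [EF' [GF' L]]]]; try assumption.
      { unfold W. now rewrite Ec, Y. }
      exists F'. split; [exact SF'|]. split; [|split; [exact GF'|]].
      + intros y. now rewrite EF'.
      + intros e. exists c. split; [|exact L]. rewrite Ec. now rewrite (proof_irrelevance _ e E).
    - exists F. split; [exact SF|]. split; [exact EF|]. split; [exact GF|]. intros e. easy. }
  destruct G as [F' [SF' [EF' [GF' L]]]].
  assert (Hp' := Hp). destruct Hp' as [_ [_ [_ U]]].
  destruct (U R_diff f F' R_diff_IsDiffeology Sf SF') as [u [Su [Ub [Uc _]]]].
  { intros y. now rewrite EF'. }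
  exists u. split; [|exact Ub]. split; [exact Su|]. split.
  - intros y Hy.
    destruct (pushout_surjective (stage_plots_open b) (stage_plots_open s) _ _ _ Hp y) as [[a E]|[c E]];
      subst y.
    + rewrite iota_stage. apply Gf. now rewrite <- Ub.
    + apply GF'. now rewrite <- Uc.
  - intros [h|h].
    + assert (Hle := lt_succ_le a0 b s hs h).
      rewrite (stage_map_comp a0 b s Hle (or_introl (proj1 hs))), Ub. apply Af.
    + destruct (L h) as [c [Ec Hc]]. rewrite <- Ec, Uc. exact Hc.
Qed.

Lemma stage_fun_spec b : stage_good b (stage_fun b) /\
  forall a (ha : lt a b) y, stage_fun b (z a b (or_introl ha) y) = stage_fun a y.
Proof.
  induction (proj1 Hord b) as [b _ IH].
  rewrite (stage_fun_eq b). unfold stage_step. apply epsilon_spec.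
  assert (Hcomp : forall a c (h : le lt a c), lt c b -> forall y, stage_fun c (z a c h y) = stage_fun a y).
  { intros a c h hc y. destruct (IH c hc) as [_ K]. destruct h as [h| <-]; [apply K|].
    now rewrite stage_map_id. }
  destruct (classic (exists a, lt a b)) as [Hne|Hemp].
  - destruct (classic (exists a, succ_of lt a b)) as [[g hg]|Hns].
    + destruct (succ_step g b hg _ (proj1 (IH g (proj1 hg)))) as [f' [G E]].
      exists f'. split; [exact G|]. intros a ha y.
      assert (Hle := lt_succ_le a g b hg ha).
      rewrite (stage_map_comp a g b Hle (or_introl (proj1 hg))), E.
      apply Hcomp, hg.
    + assert (Hl := proj2 (proj1 HX) b (conj Hne Hns)). assert (Hl' := Hl).
      destruct Hl' as [_ [_ [_ U]]].
      destruct (U R_diff (fun a _ => stage_fun a) R_diff_IsDiffeology) as [u [Su [Eu _]]].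
      { intros a ha. apply (IH a ha). }
      { intros a c ha hc h y. now apply Hcomp. }
      exists u. split; [|exact Eu]. split; [exact Su|]. split.
      * intros y Hy. destruct (colimit_surjective lt Z z stage_plots_open _ _ _ Hl y) as [a [ha [w Ew]]].
        subst y. rewrite iota_stage. apply (IH a ha). now rewrite <- Eu with (ha := ha).
      * intros [h|h].
        -- rewrite Eu. rewrite <- (stage_map_id a0 (or_intror eq_refl) x0). apply (IH a0 h).
        (* [a0] is the first stage of [x], hence a successor, so it cannot be the present limit
           stage. *)
        -- exfalso. apply Hns. rewrite <- h. exact (first_stage_succ a0 x0 x Hx0 Hmin).
  - assert (E : Z b -> False).
    { apply (proj1 (proj2 HX)). intros c Hc. apply Hemp. now exists c. }
    exists (fun _ => 0). split; [|now intros a ha y; exfalso; apply Hemp; exists a].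
    split; [|split; intros y; exfalso; apply E; [exact y|exact (z a0 b y x0)]].
    apply smoothR_const, stage_plots_open.
Qed.

End Regular.

Lemma smoothly_regular (V : X -> Prop) (x : X) : Dopen X V -> V x ->
  exists f : X -> R, smoothR f /\ 1 <= f x /\ forall y, 1 / 2 <= f y -> V y.
Proof.
  intros HV Vx.
  destruct (wf_minimal lt (proj1 Hord) (fun a => exists y, iota a y = x)) as [a0 [[x0 Hx0] Hmin]].
  { apply iota_surjective. }
  assert (Hmin' : forall b, lt b a0 -> forall y, iota b y <> x).
  { intros b Hb y E. apply (Hmin b Hb). now exists y. }
  assert (S := stage_fun_spec V HV x Vx a0 x0 Hx0 Hmin').
  set (f := stage_fun V a0 x0) in *.
  destruct HX as [_ [_ [[_ [_ [_ H]]] _]]].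
  destruct (H R_diff (fun a _ => f a) R_diff_IsDiffeology) as [u [Su [Eu _]]].
  { intros a _. apply (S a). }
  { intros a b _ _ h y. destruct h as [h| <-]; [apply (S b)|]. now rewrite stage_map_id. }
  exists u. split; [exact Su|]. split.
  - rewrite <- Hx0, (Eu a0 I). rewrite <- (stage_map_id a0 (or_intror eq_refl) x0). apply (S a0).
  - intros y Hy. destruct (iota_surjective y) as [a [w <-]]. apply (S a). now rewrite <- (Eu a I).
Qed.

End CellComplex.

(** * Partitions of unity *)

(** A Lindelöf property: every point lies in the cell attached at its first stage, a finite list
    serves each compact cell, and there are countably many cells. *)
Lemma countable_refinement {O : Type} {lt : O -> O -> Prop} (Hdelta : countable_ordinal lt)
  {Z : O -> DiffSp} {z : forall a b, le lt a b -> Z a -> Z b}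
  {X : DiffSp} {iota : forall a, Z a -> X} (HX : smooth_cell_complex lt Z z X iota)
  {T : Type} (t0 : T) (V : T -> X -> Prop) :
  (forall t, Dopen X (V t)) -> (forall x, exists t, V t x) ->
  exists s : nat -> T, forall x, exists j, V (s j) x.
Proof.
  intros HV Hcov. destruct Hdelta as [Hord [e He]].
  assert (H : forall a, exists l : list T, forall y : Z a,
     (forall b, lt b a -> forall w, iota b w <> iota a y) -> exists t, In t l /\ V t (iota a y)).
  { intros a. destruct (classic (exists g, succ_of lt g a)) as [[g hg]|N].
    - destruct (proj2 (proj2 (proj2 HX)) g a hg) as [n [phi [Phi [Hphi Hp]]]].
      destruct (cube_compact n (fun t c => V t (iota a (Phi c)))) as [l Hl].
      + intros t. apply (Dopen_preimage (fun c => iota a (Phi c))); [|apply HV].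
        apply (smooth_compose Phi (iota a)); [apply Hp|apply (iota_smooth HX)].
      + intros c. apply Hcov.
      + exists l. intros y Hmin.
        destruct (cell_interior_lift HX a g hg n phi Phi y _ Hp eq_refl (Hmin g (proj1 hg)))
          as [c [<- _]]. apply Hl.
    - exists nil. intros y Hmin. exfalso. apply N.
      exact (first_stage_succ HX a y _ eq_refl Hmin). }
  destruct (dep_choice_fun _ H) as [ls Hls].
  (* [j] codes a pair: the number of a stage and a position in its list. Codes that match no stage,
     or overrun the list, give [t0], which does no harm to a cover. *)
  exists (fun j => match asbool (exists a, e a = fst (Cantor.of_nat j)) with
    | left h => nth (snd (Cantor.of_nat j)) (ls (proj1_sig (constructive_indefinite_description _ h))) t0
    | right _ => t0
    end).
  intros x.
  destruct (wf_minimal lt (proj1 Hord) (fun a => exists y, iota a y = x)) as [a [[y Hy] Hmin]].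
  { apply (iota_surjective HX). }
  destruct (Hls a y) as [t [Ht Vt]].
  { intros b Hb w E. apply (Hmin b Hb). exists w. now rewrite E. }
  destruct (In_nth _ _ t0 Ht) as [k [_ Ek]].
  exists (Cantor.to_nat (e a, k)). rewrite Cantor.cancel_of_to. simpl.
  destruct asbool as [h|N]; [|exfalso; apply N; now exists a].
  destruct (constructive_indefinite_description _ h) as [a' Ea]. simpl.
  apply He in Ea. subst a'. now rewrite Ek, <- Hy.
Qed.

(** The complement of [V] is D-closed and contains every point where [f] is nonzero. Both
    subordination and local finiteness are proved this way. *)
Lemma not_in_supp {X : DiffSp} (f : X -> R) (V : X -> Prop) x :
  Dopen X V -> V x -> (forall y, V y -> f y = 0) -> ~ supp f x.
Proof.
  intros HV Vx H S. apply (S (fun y => ~ V y)); [| |exact Vx].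
  - apply (Dopen_ext V); [|exact HV]. intros y. split; [tauto|apply NNPP].
  - intros y Hy Vy. exact (Hy (H y Vy)).
Qed.

Lemma rsum_zero {I} (l : list I) a : (forall i, In i l -> a i = 0) -> rsum l a = 0.
Proof.
  intros H. rewrite (rsum_ext l a (fun i => 0 * a i)) by (intros i Hi; rewrite (H i Hi); ring).
  rewrite rsum_scal. ring.
Qed.

Lemma rsum_plus {I} (l : list I) a b : rsum l (fun i => a i + b i) = rsum l a + rsum l b.
Proof. unfold rsum. induction l as [|i l IH]; simpl; [ring|]. rewrite IH. ring. Qed.

Lemma rsum_seq_stable (a : nat -> R) N M : (N <= M)%nat -> (forall j, (N <= j)%nat -> a j = 0) ->
  rsum (seq 0 M) a = rsum (seq 0 N) a.
Proof.
  intros HNM H. induction HNM as [|M HNM IH]; [easy|].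
  rewrite seq_S. simpl. rewrite <- IH. unfold rsum. rewrite map_app, fold_right_app. simpl.
  rewrite H by exact HNM. now rewrite Rplus_0_r.
Qed.

Lemma rsum_single {L} (F : list L) (l : L) c : NoDup F -> In l F ->
  rsum F (fun l' => if asbool (l = l') then c else 0) = c.
Proof.
  unfold rsum. induction F as [|k F IH]; simpl; [easy|]. intros Hn Hi.
  inversion Hn as [|? ? Hk HF]; subst. destruct (asbool (l = k)) as [->|N].
  - change (c + rsum F (fun l' => if asbool (k = l') then c else 0) = c).
    rewrite rsum_zero; [ring|]. intros i Hii. destruct asbool as [->|]; easy.
  - rewrite IH; [ring|exact HF|]. destruct Hi as [->|Hi]; easy.
Qed.

(** Each [j] has exactly one label, and that label occurs once in [F], so grouping by labels loses
    and repeats nothing. *)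
Lemma rsum_fibers {L} (F : list L) (lam : nat -> L) (js : list nat) (a : nat -> R) :
  NoDup F -> (forall j, In j js -> In (lam j) F) ->
  rsum F (fun l => rsum js (fun j => if asbool (lam j = l) then a j else 0)) = rsum js a.
Proof.
  intros HF. induction js as [|j js IH]; intros H.
  - apply rsum_zero. reflexivity.
  - change (rsum F (fun l => (if asbool (lam j = l) then a j else 0) +
      rsum js (fun j => if asbool (lam j = l) then a j else 0)) = a j + rsum js a).
    rewrite rsum_plus, rsum_single, IH; try easy.
    + intros i Hi. apply H. now right.
    + apply H. now left.
Qed.

Section Assembly.
Context {X : DiffSp} (HX : IsDiffeology X) {L : Type} (U : L -> X -> Prop)
  (lam : nat -> L) (g : nat -> X -> R) (Hg : forall j, smoothR (g j))
  (HgU : forall j x, 1 / 2 <= g j x -> U (lam j) x)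
  (Hcov : forall x, exists j, 1 / 2 < g j x).

Let HX' : plots_open X := proj1 HX.

Definition peak (j : nat) (x : X) : R := flat 0 (g j x - 1 / 2).

(* Cutting [peak j] off where an earlier peak exceeds [1/(j+1)] makes the family locally finite. *)
Definition cut_peak (j : nat) (x : X) : R :=
  peak j x * rprod (seq 0 j) (fun i => flat 0 (/ INR (S j) - peak i x)).

Lemma peak_smooth j : smoothR (peak j).
Proof.
  apply (smoothR_flat HX' 0 (fun x => g j x - 1 / 2)). apply (smoothR_minus HX'); [apply Hg|].
  apply (smoothR_const HX').
Qed.

Lemma peak_nonneg j x : 0 <= peak j x.
Proof. apply flat_nonneg. Qed.

Lemma cut_peak_smooth j : smoothR (cut_peak j).
Proof.
  apply smoothR_mult; [apply peak_smooth|]. apply (smoothR_rprod HX'). intros i _.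
  apply (smoothR_flat HX' 0 (fun x => / INR (S j) - peak i x)).
  apply (smoothR_minus HX'); [apply (smoothR_const HX')|apply peak_smooth].
Qed.

Lemma cut_peak_nonneg j x : 0 <= cut_peak j x.
Proof.
  apply Rmult_le_pos; [apply peak_nonneg|]. apply rprod_nonneg. intros i _. apply flat_nonneg.
Qed.

(** The condition [g j x < 1/2] is D-open and holds at all points outside [U (lam j)]; this will
    keep supports inside the cover. *)
Lemma cut_peak_off j x : g j x < 1 / 2 -> cut_peak j x = 0.
Proof. intros H. unfold cut_peak, peak at 1. rewrite flat_0 by lra. ring. Qed.

Lemma cut_peak_eventually_0 x : exists N (V : X -> Prop), Dopen X V /\ V x /\
  forall y, V y -> forall j, (N <= j)%nat -> cut_peak j y = 0.
Proof.
  destruct (Hcov x) as [i Hi].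
  assert (Hp : 0 < peak i x) by (apply flat_pos; lra).
  destruct (archimed_cor1 (peak i x / 2)) as [M [HM HM']]; [lra|].
  (* From [S i] on, the factor with index [i] occurs in the product; from [M] on, its threshold is
     below [peak i x / 2], so it vanishes on the chosen neighbourhood. *)
  exists (Nat.max (S i) M), (fun y => peak i x / 2 < peak i y).
  split; [apply (Dopen_gt HX'), peak_smooth|]. split; [lra|].
  intros y Hy j Hj. unfold cut_peak. rewrite (rprod_zero _ _ i); [ring| |].
  - apply in_seq. lia.
  - apply flat_0. assert (/ INR (S j) <= / INR M); [|lra].
    apply Rinv_le_contravar; [now apply lt_0_INR|apply le_INR; lia].
Qed.

(** For the least [j] with [g j x > 1/2] all earlier peaks vanish at [x], so no factor cuts [peak j]
    off there. *)
Lemma cut_peak_cover x : exists j, 0 < cut_peak j x.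
Proof.
  destruct (wf_minimal Peano.lt Wf_nat.lt_wf (fun j => 1 / 2 < g j x) (Hcov x)) as [j [Hj Hmin]].
  exists j. apply Rmult_lt_0_compat; [apply flat_pos; lra|]. apply rprod_pos. intros i Hi.
  apply flat_pos. apply in_seq in Hi. assert (N := Hmin i ltac:(lia)).
  unfold peak. rewrite flat_0 by lra. rewrite Rminus_0_r. apply Rinv_0_lt_compat, lt_0_INR. lia.
Qed.

Lemma partition_of_unity_of_cover : exists psi : L -> X -> R, partition_of_unity X U psi.
Proof.
  destruct (dep_choice_fun _ cut_peak_eventually_0) as [N HN].
  destruct (dep_choice_fun _ HN) as [V HV]. clear HN.
  set (part := fun l j y => if asbool (lam j = l) then cut_peak j y else 0).
  set (tot := fun x => rsum (seq 0 (N x)) (fun j => cut_peak j x)).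
  set (num := fun l x => rsum (seq 0 (N x)) (fun j => part l j x)).
  assert (Hself : forall x j, (N x <= j)%nat -> cut_peak j x = 0).
  { intros x. apply HV, HV. }
  (* The truncation [N y] varies with the point, but on [V x] both [N x] and [N y] omit only zero
     terms. Near [x] the sums thus have a fixed finite length, which yields smoothness. *)
  assert (stable : forall (a : nat -> R) x y, V x y -> (forall j, cut_peak j y = 0 -> a j = 0) ->
     rsum (seq 0 (N y)) a = rsum (seq 0 (N x)) a).
  { intros a x y Vy Ha.
    destruct (Nat.le_gt_cases (N x) (N y)) as [H|H].
    - apply rsum_seq_stable; [exact H|]. intros j Hj. apply Ha. now apply (HV x).
    - symmetry. apply rsum_seq_stable; [lia|]. intros j Hj. apply Ha. now apply Hself. }
  assert (part0 : forall l j y, cut_peak j y = 0 -> part l j y = 0).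
  { intros l j y H. unfold part. now destruct asbool. }
  assert (part_bounds : forall l j y, 0 <= part l j y <= cut_peak j y).
  { intros l j y. unfold part. assert (K := cut_peak_nonneg j y). destruct asbool; lra. }
  assert (tot_pos : forall x, 0 < tot x).
  { intros x. destruct (cut_peak_cover x) as [j Hj]. eapply Rlt_le_trans; [exact Hj|].
    apply (rsum_term_le (seq 0 (N x)) (fun j => cut_peak j x)); [intros; apply cut_peak_nonneg|].
    apply in_seq. destruct (Nat.le_gt_cases (N x) j) as [H|H]; [|lia].
    rewrite (Hself x j H) in Hj. lra. }
  assert (num_bounds : forall l x, 0 <= num l x <= tot x).
  { intros l x. split; [apply rsum_nonneg; intros j _; apply part_bounds|].
    assert (K : 0 <= rsum (seq 0 (N x)) (fun j => cut_peak j x - part l j x)).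
    { apply rsum_nonneg. intros j _. specialize (part_bounds l j x). lra. }
    rewrite rsum_minus in K. unfold num, tot. lra. }
  assert (tot_smooth : smoothR tot).
  { apply (smoothR_local HX). intros x. exists (V x), (fun y => rsum (seq 0 (N x)) (fun j => cut_peak j y)).
    destruct (HV x) as [Vo [Vx _]]. split; [exact Vo|]. split; [exact Vx|]. split.
    - apply (smoothR_rsum HX'). intros j _. apply cut_peak_smooth.
    - intros y Vy. now apply stable. }
  assert (num_smooth : forall l, smoothR (num l)).
  { intros l. apply (smoothR_local HX). intros x.
    exists (V x), (fun y => rsum (seq 0 (N x)) (fun j => part l j y)).
    destruct (HV x) as [Vo [Vx _]]. split; [exact Vo|]. split; [exact Vx|]. split.
    - apply (smoothR_rsum HX'). intros j _. unfold part.
      destruct asbool; [apply cut_peak_smooth|apply (smoothR_const HX')].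
    - intros y Vy. apply stable; [exact Vy|]. intros j. apply part0. }
  assert (num_local : forall l x y, V x y -> (forall j, (j < N x)%nat -> lam j = l -> cut_peak j y = 0) ->
     num l y * / tot y = 0).
  { intros l x y Vy H. unfold num. rewrite (stable _ x y Vy) by (intros j; apply part0).
    rewrite rsum_zero; [ring|]. intros j Hj. apply in_seq in Hj. unfold part.
    destruct asbool as [E|]; [|easy]. apply H; [lia|exact E]. }
  assert (absent : forall l x y, V x y -> ~ In l (map lam (seq 0 (N x))) -> num l y * / tot y = 0).
  { intros l x y Vy H. apply (num_local l x y Vy). intros j Hj <-. exfalso. apply H.
    apply in_map, in_seq. lia. }
  exists (fun l x => num l x * / tot x). split; [|split; [|split; [|split]]].
  - intros l. apply smoothR_mult; [apply num_smooth|]. apply smoothR_inv; [exact tot_smooth|].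
    intros x. specialize (tot_pos x). lra.
  - intros l x. specialize (tot_pos x). specialize (num_bounds l x).
    assert (P := Rinv_0_lt_compat _ tot_pos). split; [apply Rmult_le_pos; lra|].
    apply Rle_trans with (tot x * / tot x); [apply Rmult_le_compat_r; lra|]. right. field. lra.
  - intros l x S. apply NNPP. intros NU. revert S.
    (* Outside [U l], each of the finitely many relevant [g j] with label [l] is below 1/2. This
       persists on a D-open neighbourhood, where the function therefore vanishes. *)
    apply (not_in_supp _ (fun y => V x y /\ forall j, In j (seq 0 (N x)) -> lam j = l -> g j y < 1 / 2)).
    + apply Dopen_and; [apply HV|].
      apply (Dopen_forall HX' (seq 0 (N x)) (fun j y => lam j = l -> g j y < 1 / 2)).
      intros j. destruct (asbool (lam j = l)) as [E|E].
      * apply (Dopen_ext (fun y => g j y < 1 / 2)); [tauto|]. now apply Dopen_lt.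
      * apply (Dopen_ext (fun _ => True)); [tauto|]. apply (Dopen_const HX').
    + split; [apply HV|]. intros j _ <-. apply Rnot_le_lt. intros H. apply NU. now apply HgU.
    + intros y [Vy H]. apply (num_local l x y Vy). intros j Hj E. apply cut_peak_off, H; [|exact E].
      apply in_seq. lia.
  - intros x. exists (V x). split; [apply HV|]. split; [apply HV|].
    exists (map lam (seq 0 (N x))). intros l [y [Vy S]]. apply NNPP. intros NI. revert S.
    apply (not_in_supp _ (V x)); [apply HV|exact Vy|]. intros w Vw. now apply (absent l x w).
  - intros x. set (F := nodup (fun a b => asbool (a = b)) (map lam (seq 0 (N x)))).
    exists F. split; [apply NoDup_nodup|]. split.
    + intros l H. apply nodup_In. apply NNPP. intros NI. apply H, (absent l x x); [apply HV|exact NI].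
    + change (rsum F (fun l => num l x * / tot x) = 1).
      rewrite (rsum_ext _ _ (fun l => / tot x * num l x)) by (intros; ring).
      rewrite rsum_scal. unfold num, part. rewrite rsum_fibers.
      * fold (tot x). field. specialize (tot_pos x). lra.
      * apply NoDup_nodup.
      * intros j Hj. apply nodup_In. now apply in_map.
Qed.

End Assembly.

Theorem theorem6 (O : Type) (lt : O -> O -> Prop) (Hdelta : countable_ordinal lt)
  (Z : O -> DiffSp) (z : forall a b, le lt a b -> Z a -> Z b)
  (X : DiffSp) (iota : forall a, Z a -> X)
  (HX : smooth_cell_complex lt Z z X iota)
  (L : Type) (U : L -> X -> Prop)
  (HUopen : forall l, Dopen X (U l)) (HUcov : forall x : X, exists l, U l x) :
  exists psi : L -> X -> R, partition_of_unity X U psi.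
Proof.
  assert (HXd : IsDiffeology X) by exact (proj1 (proj1 (proj2 (proj2 HX)))).
  (* The enumeration needs a default element. If there are no labels, the cover forces [X] to be
     empty. *)
  destruct (classic (inhabited L)) as [[l0]|NL].
  (* The refined cover consists of the sets [{f > 1/2}], indexed by label and function together, so
     that the enumeration returns the functions themselves. *)
  - set (T := {p : L * (X -> R) | smoothR (snd p) /\ forall y, 1 / 2 <= snd p y -> U (fst p) y}).
    assert (t0 : T).
    { exists (l0, fun _ => 0). split; [apply (smoothR_const (proj1 HXd))|]. simpl. intros y Hy. lra. }
    destruct (countable_refinement Hdelta HX t0 (fun (t : T) x => 1 / 2 < snd (proj1_sig t) x))
      as [s Hs].
    + intros t. apply (Dopen_gt (proj1 HXd)), (proj2_sig t).
    + intros x. destruct (HUcov x) as [l Ul].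
      destruct (smoothly_regular (proj1 Hdelta) HX (U l) x (HUopen l) Ul) as [f [Sf [fx Hf]]].
      exists (exist _ (l, f) (conj Sf Hf)). simpl. lra.
    + apply (partition_of_unity_of_cover HXd U (fun j => fst (proj1_sig (s j)))
        (fun j => snd (proj1_sig (s j)))); [| |exact Hs]; intros j; apply (proj2_sig (s j)).
  - assert (NX : X -> False).
    { intros x. destruct (HUcov x) as [l _]. apply NL. now constructor. }
    exists (fun _ _ => 0). split; [|split; [|split; [|split]]];
      try (intros l; exfalso; apply NL; now constructor); intros x; now exfalso.
Qed.
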